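(* Let $G$ be a simply connected five dimensional nilpotent Lie group with a left invariant Riemannian metric $\tilde a$, whose Lie algebra $\mathfrak l_{5,5}$ has an $\tilde a$-orthonormal basis $\{E_1,\dots,E_5\}$ with non-zero brackets $[E_1,E_2]=aE_4+bE_5$, $[E_1,E_3]=cE_5$, $[E_1,E_4]=dE_5$, $[E_2,E_3]=eE_5$, where $a,d,e>0$ and $b,c\ge0$. Let $F$ be a left invariant non-Riemannian Randers metric of Douglas type on $G$, induced by $\tilde a$ and a left invariant vector field $X=\lambda_1E_1+\lambda_2E_2+\lambda_3E_3$. Then the $S$-curvature of $F$ is given by $$S(Y)=3\left\{\frac{(y_1\lambda_2-y_2\lambda_1)(ay_4+by_5)+y_5\lambda_3(cy_1+ey_2)-y_5\lambda_1(cy_3+dy_4)-e\lambda_2y_3y_5}{F(Y)}\right\},$$ where $Y=y_1E_1+y_2E_2+y_3E_3+y_4E_4+y_5E_5$ (non-zero).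
   Context: Brackets of basis elements not listed (and not obtained by antisymmetry) are zero. The Randers metric induced by $\tilde a$ and $X$, where $\sqrt{\tilde a(X,X)}<1$, is $F(x,y)=\sqrt{\tilde a(y,y)}+\tilde a(X(x),y)$. The spray coefficients of $F$ in standard local coordinates $(x,y)$ of the tangent bundle are $G^i=\frac14 g^{il}\big([F^2]_{x^my^l}y^m-[F^2]_{x^l}\big)$, where $g_{ij}=\frac12\frac{\partial^2F^2}{\partial y^i\partial y^j}$. $F$ is of Douglas type if in every standard local coordinate system $G^i=\frac12\Gamma^i_{jk}(x)y^jy^k+P(x,y)y^i$ for some functions $\Gamma^i_{jk}(x)$ and some local function $P(x,y)$ positively homogeneous of degree one in $y$. The $S$-curvature (Shen), with respect to the Busemann–Hausdorff volume form $\sigma(x)\,dx^1\cdots dx^n$, $\sigma(x)=\mathrm{Vol}(\text{unit ball of }\mathbb R^n)/\mathrm{Vol}\{(y^i)\in\mathbb R^n: F(x,y^i\partial_{x^i})<1\}$, is $S(x,y)=\frac{\partial G^m}{\partial y^m}(x,y)-y^m\frac{\partial\ln\sigma}{\partial x^m}(x)$; $S(Y)$ and $F(Y)$ denote the values of $S$ and $F$ at $Y$ in the Lie algebra, i.e. the tangent space at the identity element of $G$. *)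

(* Defs.v *)
From HB Require Import structures.
From mathcomp Require Import all_boot all_order all_algebra.
From mathcomp Require Import all_classical all_reals all_analysis.
Set Implicit Arguments.
Unset Strict Implicit.
Unset Printing Implicit Defensive.
Import Order.TTheory GRing.Theory Num.Theory.
Import numFieldNormedType.Exports.
Local Open Scope classical_set_scope.
Local Open Scope ring_scope.

(* Points and tangent vectors of R^n are row vectors; as in derive.v, the
   Jacobian 'J f x acts on the right: df_x(v) = v *m 'J f x. *)

Section calculus.
Context {R : realType}.

Definition partial n (W : normedModType R) (i : 'I_n) (f : 'rV[R]_n -> W) :
  'rV[R]_n -> W := fun x => 'D_(delta_mx 0 i) f x.

(* C^oo on an open set U: all iterated partial derivatives exist and are
   (Frechet) differentiable, hence continuous, on U. *)
Definition smooth_on n (W : normedModType R) (U : set 'rV[R]_n)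
    (f : 'rV[R]_n -> W) : Prop :=
  forall (s : seq 'I_n) x, U x ->
    differentiable (foldr (@partial n W) f s) x.

(* n-dimensional Lebesgue measure of a Borel set, as the n-fold product of
   lebesgue_measure: the recursion is that of product_measure1, i.e. integration
   of the measures of the sections with respect to the first coordinate. *)
Fixpoint volume n : set 'rV[R]_n -> \bar R :=
  match n with
  | 0 => fun B => (\1_B (0 : 'rV[R]_0))%:E
  | m.+1 => fun B => (\int[lebesgue_measure]_t
      @volume m [set v | B (row_mx (t%:M : 'M[R]_1) v : 'rV[R]_(1 + m))])%E
  end.

Definition unit_ball n : set 'rV[R]_n := [set y | \sum_i y 0 i ^+ 2 < 1].

End calculus.

Record chart (R : realType) (M : topologicalType) (n : nat) := Chart {
  dom : set M;
  cod : set 'rV[R]_n;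
  crd : M -> 'rV[R]_n;
  pnt : 'rV[R]_n -> M;
  chart_open_dom : open dom;
  chart_open_cod : open cod;
  chart_crd : forall m, dom m -> cod (crd m);
  chart_pnt : forall x, cod x -> dom (pnt x);
  chart_crdK : forall m, dom m -> pnt (crd m) = m;
  chart_pntK : forall x, cod x -> crd (pnt x) = x;
  chart_crd_continuous : {within dom, continuous crd};
  chart_pnt_continuous : {within cod, continuous pnt} }.

Section manifold.
Context {R : realType} {M : topologicalType} {n : nat}.
Local Notation chart := (chart R M n).
Implicit Types (p q : chart) (A : set chart) (phi : M -> M).

(* Coordinate expression of phi in the charts p and q, and its domain. *)
Definition loc phi p q : 'rV[R]_n -> 'rV[R]_n := crd q \o phi \o pnt p.
Definition loc_dom phi p q : set 'rV[R]_n :=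
  [set x | cod p x /\ dom q (phi (pnt p x))].

Definition compatible p q : Prop :=
  smooth_on (loc_dom id p q) (loc id p q) /\
  smooth_on (loc_dom id q p) (loc id q p).

(* A is a maximal smooth atlas: its members are exactly the local coordinate
   systems of the manifold. *)
Record smooth_manifold A : Prop := SmoothManifold {
  manifold_hausdorff : hausdorff_space M;
  manifold_countable : @second_countable M;
  manifold_cover : forall m, exists2 p, A p & dom p m;
  manifold_compatible : forall p q, A p -> A q -> compatible p q;
  manifold_maximal : forall p, (forall q, A q -> compatible p q) -> A p }.

(* Tensorial objects are given by their components in every chart, as functions
   of the coordinates; only the values on cod p, for p in the atlas, matter.
   A vector field is X p x = (X^i(x))_i, a covariant 2-tensor is
   h p x = (h_ij(x))_ij, and a function on the tangent bundle is F p x y, in the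
   standard coordinates (x, y) induced by p. *)
Definition field := chart -> 'rV[R]_n -> 'rV[R]_n.
Definition tensor2 := chart -> 'rV[R]_n -> 'M[R]_n.
Definition tfunction := chart -> 'rV[R]_n -> 'rV[R]_n -> R.
Implicit Types (X Y : field) (h : tensor2) (F : tfunction).

Definition field_eq A X Y : Prop :=
  forall p, A p -> forall x, cod p x -> X p x = Y p x.

(* Invariance under phi; for phi = id this is the transformation law of the
   components under a change of coordinates. *)
Definition preserves_field A phi X : Prop :=
  forall p q, A p -> A q -> forall x, loc_dom phi p q x ->
    X q (loc phi p q x) = X p x *m 'J (loc phi p q) x.
Definition preserves_tensor2 A phi h : Prop :=
  forall p q, A p -> A q -> forall x, loc_dom phi p q x ->
    'J (loc phi p q) x *m h q (loc phi p q x) *m ('J (loc phi p q) x)^T = h p x.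
Definition preserves_tfunction A phi F : Prop :=
  forall p q, A p -> A q -> forall x, loc_dom phi p q x -> forall y,
    F q (loc phi p q x) (y *m 'J (loc phi p q) x) = F p x y.

Definition vector_field A X : Prop :=
  (forall p, A p -> smooth_on (cod p) (X p)) /\ preserves_field A id X.

Definition bracket X Y : field :=
  fun p x => 'D_(X p x) (Y p) x - 'D_(Y p x) (X p) x.

Definition inner h p x (v w : 'rV[R]_n) : R := (v *m h p x *m w^T) 0 0.

Record riemannian_metric A h : Prop := RiemannianMetric {
  metric_smooth : forall p, A p ->
    forall i j, smooth_on (cod p) (fun x => h p x i j);
  metric_tensor : preserves_tensor2 A id h;
  metric_sym : forall p, A p -> forall x, cod p x -> (h p x)^T = h p x;
  metric_pos : forall p, A p -> forall x, cod p x ->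
    forall v, v != 0 -> 0 < inner h p x v v }.

Definition randers h X : tfunction :=
  fun p x y => Num.sqrt (inner h p x y y) + inner h p x (X p x) y.

Definition is_riemannian A F : Prop :=
  exists2 h, riemannian_metric A h &
    forall p, A p -> forall x, cod p x -> forall y,
      F p x y = Num.sqrt (inner h p x y y).

Definition fundamental_tensor F p (x y : 'rV[R]_n) : 'M[R]_n :=
  \matrix_(i, j)
    (2^-1 * partial i (partial j (fun y' => F p x y' ^+ 2)) y).

Definition spray F p (x y : 'rV[R]_n) (i : 'I_n) : R :=
  4^-1 * \sum_l invmx (fundamental_tensor F p x y) i l *
    (\sum_m partial l (fun y' => partial m (fun x' => F p x' y' ^+ 2) x) y
              * y 0 m
     - partial l (fun x' => F p x' y ^+ 2) x).

Definition douglas A F : Prop :=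
  forall p, A p ->
  exists (Gam : 'I_n -> 'I_n -> 'I_n -> 'rV[R]_n -> R)
         (P : 'rV[R]_n -> 'rV[R]_n -> R),
    forall x, cod p x -> forall y, y != 0 ->
      (forall t, 0 < t -> P x (t *: y) = t * P x y) /\
      (forall i, spray F p x y i =
         2^-1 * (\sum_j \sum_k Gam i j k x * y 0 j * y 0 k) + P x y * y 0 i).

(* Busemann-Hausdorff density. *)
Definition bh_density F p (x : 'rV[R]_n) : R :=
  fine (volume (@unit_ball R n)) / fine (volume [set y | F p x y < 1]).

Definition S_curvature F p (x y : 'rV[R]_n) : R :=
  \sum_m partial m (fun y' => spray F p x y' m) y
  - \sum_m y 0 m * partial m (fun x' => ln (bh_density F p x')) x.

End manifold.

Definition simply_connected (R : realType) (T : topologicalType) : Prop :=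
  (forall x y : T, exists f : R -> T,
     [/\ {within `[0, 1], continuous f}, f 0 = x & f 1 = y]) /\
  (forall f : R -> T, {within `[0, 1], continuous f} -> f 0 = f 1 ->
     exists H : R * R -> T,
       {within `[0, 1] `*` `[0, 1], continuous H} /\
       (forall t, t \in `[0, 1] ->
          [/\ H (0, t) = f t, H (1, t) = f 0, H (t, 0) = f 0
            & H (t, 1) = f 0])).

(* No compatibility between the two structures yet, see lie_group. *)
#[short(type="preTopologicalGroupType")]
HB.structure Definition PreTopologicalGroup :=
  {G of monoid.Group G & Topological G}.

(* Upper central series. *)
Fixpoint upper_central (G : groupType) (k : nat) : set G :=
  match k with
  | 0 => [set 1%g]
  | k'.+1 => [set x | forall y, @upper_central G k' [~ x, y]%g]
  end.

Definition nilpotent_group (G : groupType) : Prop :=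
  exists k, @upper_central G k = setT.

Section lie_group.
Context {R : realType} {G : preTopologicalGroupType} {n : nat}.
Local Notation chart := (chart R G n).
Implicit Type A : set chart.

Record lie_group A : Prop := LieGroup {
  lie_manifold : smooth_manifold A;
  lie_mul_continuous : continuous (fun z : G * G => (z.1 * z.2)%g);
  lie_mul_smooth : forall p q r, A p -> A q -> A r ->
    smooth_on
      [set z : 'rV[R]_(n + n) | [/\ cod p (lsubmx z), cod q (rsubmx z)
         & dom r (pnt p (lsubmx z) * pnt q (rsubmx z))%g]]
      (fun z => crd r (pnt p (lsubmx z) * pnt q (rsubmx z))%g);
  lie_inv_continuous : continuous (fun g : G => g^-1%g);
  lie_inv_smooth : forall p q, A p -> A q ->
    smooth_on (loc_dom (fun g : G => g^-1%g) p q)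
              (loc (fun g : G => g^-1%g) p q) }.

Definition left_invariant_field A (X : field) : Prop :=
  vector_field A X /\
  forall g : G, preserves_field A (fun k => (g * k)%g) X.

Definition left_invariant_metric A (h : tensor2) : Prop :=
  riemannian_metric A h /\
  forall g : G, preserves_tensor2 A (fun k => (g * k)%g) h.

Definition left_invariant_tfunction A (F : tfunction) : Prop :=
  forall g : G, preserves_tfunction A (fun k => (g * k)%g) F.

(* A basis of the Lie algebra of left invariant fields: n = dim G orthonormal
   elements of it; their independence and spanning are automatic. *)
Definition orthonormal_basis A (h : tensor2) (E : 'I_n -> field) : Prop :=
  (forall i, left_invariant_field A (E i)) /\
  (forall p, A p -> forall x, cod p x ->
     forall i j, inner h p x (E i p x) (E j p x) = (i == j)%:R).

End lie_group.

(* Main.v *)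
Require Import Defs.
From HB Require Import structures.
From mathcomp Require Import all_boot all_order all_algebra.
From mathcomp Require Import fingroup perm.
From mathcomp Require Import all_classical all_reals all_analysis.
From mathcomp Require Import measurable_realfun.
From mathcomp Require Import ring lra.
Set Implicit Arguments.
Unset Strict Implicit.
Unset Printing Implicit Defensive.
Import Order.TTheory GRing.Theory Num.Theory.
Import numFieldNormedType.Exports.
Local Open Scope classical_set_scope.
Local Open Scope ring_scope.

(** The S-curvature of a left invariant Randers metric with closed 1-form is
    (n + 1) P, where the spray is G^i = G_alpha^i + P y^i; the reason is that
    the Riemannian part of the spray and the Busemann-Hausdorff density
    contribute opposite logarithmic derivatives of the same determinant.

    Let M(x) be the matrix whose rows are the orthonormal left invariant frame
    and N(x) = M(x)^-1 its coframe. In these terms F(x, y) = f(y N(x)) with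
    f(v) = |v| + <lam, v> a fixed norm on the Lie algebra, so all x-derivatives
    of F come from N. The frame relations [E_i, E_j] = c_ij become the
    Maurer-Cartan equation for N ([maurer_cartan_frame]), and inserting it in the
    Euler-Lagrange expression gives, with v = y N and
    D_y N = sum_m y_m (d N / d x_m),
      G(x, y) = (y (D_y N) + Z(v)) M / 2,
    where Z solves the Euler-Arnold equation
    Hess(f^2)(v)(Z, w) = - d(f^2)(v)([v, w]) ([sprayE]). Nothing has to be
    inverted: it suffices that the Hessian is nondegenerate
    ([hess_energy_definite]) and that Z satisfies the equation.

    The field X is orthogonal to the derived algebra, which is spanned by E_4
    and E_5. Hence
      Z(v) = Z_0(v) + (<v, [v, lam]> / f(v)) v,
    with Z_0 the Riemannian solution, <Z_0(v), w> = - <v, [v, w]>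
    ([euler_arnold]). As the algebra is unimodular, Z_0 is divergence free, the
    second term is homogeneous of degree two along the radial field, and the
    divergence of G is tr((D_y N) M) + (n + 1)/2 <v, [v, lam]> / f(v)
    ([spray_divergence]).

    For the density, {y | F(x, y) < 1} is an ellipsoid, the preimage under N(x)
    of a fixed one, so that its volume is a constant over |det N(x)|
    ([volume_indicatrix]). By Jacobi's formula the derivative of the logarithm of
    the density along y is tr((D_y N) M) ([partial_ln_bh_density]), which cancels
    the first term of the divergence. With n = 5 the factor is 3, and
    <v, [v, lam]> is read off the structure constants ([l55_quadratic]). *)

(** * Volumes of balls and ellipsoids *)

Section affine.
Context {R : realType}.
Local Notation mu := (@lebesgue_measure R).

Definition affine_map (k c : R) (t : measurableTypeR R) : measurableTypeR R :=
  k * t + c.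

Lemma measurable_affine_map (k c : R) : measurable_fun setT (affine_map k c).
Proof. by apply: measurable_funD => //; exact: measurable_funM. Qed.

(** The right-hand side is a measure in [B], so it is enough to compare the two
    sides on half-open intervals. *)
Lemma lebesgue_measure_affine (k c : R) (k0 : 0 < k) (B : set R) :
  measurable B ->
  mu B = (k%:E * mu ((fun t => (k * t + c)%R) @^-1` B))%E.
Proof.
move=> mB; pose nk : {nonneg R} := NngNum (ltW k0).
pose f := affine_map k c.
have mf : measurable_fun setT f := measurable_affine_map k c.
pose nu0 : {measure set (measurableTypeR R) -> \bar R} :=
  mscale nk (pushforward mu f).
pose nu := nu0 mf.
have -> := @lebesgue_measure_unique R nu _ B mB; first by [].
move=> _ [[x y] /= _ <-].
rewrite /nu /nu0 /mscale/= /pushforward /f.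
have -> : f @^-1` `]x, y] = `](x - c) / k, (y - c) / k]%classic :> set R.
  apply/seteqP; split => t /=; rewrite !in_itv/= /f /=;
  rewrite ltr_pdivrMr// ler_pdivlMr// ltrBlDr lerBrDr mulrC//.
rewrite !lebesgue_measure_itv/= !lte_fin ltr_pM2r ?invr_gt0// ltrBlDr subrK.
case: ifP => _; last by rewrite mule0.
by rewrite -!EFinB -EFinM; congr EFin; field; rewrite gt_eqF.
Qed.

Lemma ge0_integral_affine (k c : R) (k0 : 0 < k)
    (f : R -> \bar R) :
  measurable_fun [set: R] f -> (forall t, 0 <= f t)%E ->
  (\int[mu]_t f (k * t + c)%R = k^-1%:E * \int[mu]_t f t)%E.
Proof.
move=> mf f0.
pose nk : {nonneg R} := NngNum (ltW k0).
pose g := affine_map k c.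
have mg : measurable_fun setT g := measurable_affine_map k c.
pose nu0 : {measure set (measurableTypeR R) -> \bar R} :=
  mscale nk (pushforward mu g).
pose nu := nu0 mg.
rewrite [in RHS](@eq_measure_integral _ _ _ setT nu); last first.
  by move=> B mB _; exact: lebesgue_measure_affine.
rewrite ge0_integral_mscale// ge0_integral_pushforward//.
by rewrite muleA -EFinM/= mulVf ?gt_eqF// mul1e preimage_setT.
Qed.

End affine.

Section ball_volume.
Context {R : realType}.
Local Notation mu := (@lebesgue_measure R).

Definition sqball n (s : R) : set 'rV[R]_n := [set v | \sum_i v 0 i ^+ 2 < s].

Lemma sum_sqr_row_mx n (t : R) (v : 'rV[R]_n) :
  \sum_i (row_mx (t%:M : 'M[R]_1) v : 'rV[R]_(1 + n)) 0 i ^+ 2 =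
  t ^+ 2 + \sum_i v 0 i ^+ 2.
Proof.
rewrite big_split_ord/= big_ord1 row_mxEl !mxE eqxx mulr1n.
by under eq_bigr do rewrite row_mxEr.
Qed.

(** The section at first coordinate [t] of the ball of squared radius [s] is the
    ball of squared radius [s - t ^+ 2]; indexing balls by squared radius makes
    this recursion free of square roots. *)
Lemma volume_sqballS n (s : R) :
  volume (@sqball n.+1 s) = (\int[mu]_t volume (@sqball n (s - t ^+ 2)%R))%E.
Proof.
rewrite /=; apply: eq_integral => t _; congr volume.
by apply/seteqP; split => v; rewrite /sqball/= sum_sqr_row_mx ltrBrDl.
Qed.

Lemma measurable_ndecr_subX2 (w : R -> R) (s : R) :
  {homo w : x y / x <= y} ->
  measurable_fun [set: R] (fun t => (w (s - t ^+ 2))%:E).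
Proof.
move=> wh; apply/measurable_EFinP.
have mw : measurable_fun [set: R] w by exact: nondecreasing_measurable.
by apply: (measurableT_comp mw); apply: measurable_funB.
Qed.

(** Monotonicity of [w] is part of the induction: it makes the integrand of the
    next dimension measurable. *)
Lemma sqball_volume n : exists w : R -> R,
  [/\ forall s, volume (@sqball n s) = (w s)%:E, {homo w : x y / x <= y},
      forall s, s <= 0 -> w s = 0 & forall s, 0 < s -> 0 < w s].
Proof.
elim: n => [|n [w [wE wh w0 wp]]].
  exists (fun s : R => (0 < s)%R%:R); split => [s|x y xy|s s0|s ->//]; last first.
  - by rewrite ltNge s0.
  - by rewrite ler_nat; case: ltP => // x0; rewrite (lt_le_trans x0 xy).
  - rewrite /= indicE; congr ((nat_of_bool _)%:R%:E).
    by apply/idP/idP; rewrite inE /sqball/= big_ord0.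
have w_ge0 s : 0 <= w s.
  by case: (lerP s 0) => [/w0->//|/wp/ltW].
pose I s := (\int[mu]_t (w (s - t ^+ 2)%R)%:E)%E.
have volE s : volume (@sqball n.+1 s) = I s.
  by rewrite volume_sqballS; apply: eq_integral => t _; rewrite wE.
have Ige0 s : (0 <= I s)%E by apply: integral_ge0 => t _; rewrite lee_fin.
have mI s := measurable_ndecr_subX2 s wh.
have Ih x y : x <= y -> (I x <= I y)%E.
  move=> xy; apply: ge0_le_integral => //; try exact: mI.
    by move=> t _; rewrite lee_fin.
  by move=> t _; rewrite lee_fin wh// lerD2r.
have I0 s : s <= 0 -> I s = 0%E.
  move=> s0; rewrite /I integral0_eq// => t _.
  by rewrite w0// subr_le0 (le_trans s0) ?sqr_ge0.
have int_itv (r k : R) : 0 <= r -> 0 <= k ->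
    (\int[mu]_t (k * \1_(`[- r, r]%classic : set R) t)%:E = (k * (r + r))%:E)%E.
  move=> r0 k0; under eq_integral do rewrite EFinM.
  rewrite ge0_integralZl//=; last first.
    by apply/measurable_EFinP; exact: measurable_indic.
  rewrite integral_indic//= setIT lebesgue_measure_itv/= lte_fin.
  by case: ltrP => h; rewrite -?EFinB ?mule0 -?EFinM; congr EFin; nra.
have mitv (r k : R) :
    measurable_fun [set: R] (fun t => (k * \1_(`[- r, r]%classic : set R) t)%:E).
  by apply/measurable_EFinP; apply: measurable_funM => //; exact: measurable_indic.
have Ifin s : (I s < +oo)%E.
  (* Outside [-r, r] one has s <= t ^+ 2, and there [w] vanishes. *)
  pose r := 1 + `|s|.
  have r0 : 0 <= r by rewrite addr_ge0.
  apply: (@le_lt_trans _ _ (w s * (r + r))%:E); last exact: ltry.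
  rewrite -int_itv//.
  apply: ge0_le_integral; try exact: mI; try exact: mitv; try exact: measurableT.
    by move=> t _; rewrite lee_fin.
  move=> t _.
  rewrite lee_fin indicE; case: (boolP (t \in _)) => [_|].
    by rewrite mulr1 wh// gerBl sqr_ge0.
  rewrite notin_setE/= in_itv/= mulr0 => /negP tr.
  rewrite w0// subr_le0 (le_trans (ler_norm s))//.
  rewrite -ler_norml -ltNge /r in tr.
  rewrite -[leRHS]real_normK ?num_real//.
  by have := normr_ge0 s; nra.
(* With r <= 1/2 and r <= s/2, t ^+ 2 <= s/2 on [-r, r]. *)
have Ipos s : 0 < s -> (0 < I s)%E.
  move=> s0; pose r := Num.min 1 s / 2.
  have m0 : 0 < Num.min 1 s by rewrite lt_min ltr01.
  have m1 : Num.min 1 s <= 1 by rewrite ge_min lexx.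
  have ms : Num.min 1 s <= s by rewrite ge_min lexx orbT.
  have r0 : 0 < r by rewrite /r; lra.
  apply: (@lt_le_trans _ _ (w (s / 2) * (r + r))%:E).
    by rewrite lte_fin mulr_gt0 ?wp//; lra.
  rewrite -int_itv//; last exact: ltW.
  apply: ge0_le_integral; try exact: mI; try exact: mitv; try exact: measurableT.
    by move=> t _; rewrite lee_fin mulr_ge0.
  move=> t _.
  rewrite lee_fin indicE; case: (boolP (t \in _)) => [|_]; last by rewrite mulr0.
  rewrite inE/= in_itv/= mulr1 => /andP[t1 t2]; apply: wh.
  have r1 : r <= 1 / 2 by rewrite /r; lra.
  have rs : r <= s / 2 by rewrite /r; lra.
  by nra.
have IE s : I s = (fine (I s))%:E by rewrite fineK// ge0_fin_numE.
exists (fun s => fine (I s)); split => [s|x y xy|s /I0->//|s s0].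
- by rewrite volE.
- by rewrite fine_le ?Ih// ge0_fin_numE.
- by rewrite -lte_fin -IE Ipos.
Qed.

End ball_volume.

Section ellipsoid_volume.
Context {R : realType}.
Local Notation mu := (@lebesgue_measure R).

Definition ball_vol n (s : R) : R := fine (volume (@sqball R n s)).

Lemma volume_sqball n s : volume (@sqball R n s) = (ball_vol n s)%:E.
Proof. by have [w [wE _ _ _]] := @sqball_volume R n; rewrite /ball_vol wE. Qed.

Lemma ball_vol_homo n : {homo @ball_vol n : x y / x <= y}.
Proof.
have [w [wE wh _ _]] := @sqball_volume R n.
by move=> x y /wh; rewrite /ball_vol !wE.
Qed.

Lemma ball_vol_ge0 n s : 0 <= ball_vol n s.
Proof.
have [w [wE _ w0 wp]] := @sqball_volume R n; rewrite /ball_vol wE /=.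
by case: (lerP s 0) => [/w0->//|/wp/ltW].
Qed.

Lemma ball_vol_gt0 n s : 0 < s -> 0 < ball_vol n s.
Proof.
by have [w [wE _ _ wp]] := @sqball_volume R n; rewrite /ball_vol wE => /wp.
Qed.

Lemma ball_volS n s :
  ((ball_vol n.+1 s)%:E = \int[mu]_t (ball_vol n (s - t ^+ 2)%R)%:E)%E.
Proof.
rewrite -volume_sqball volume_sqballS; apply: eq_integral => t _.
by rewrite volume_sqball.
Qed.

Definition qform n (Q : 'M[R]_n) (v : 'rV[R]_n) : R := (v *m Q *m v^T) 0 0.

Definition posdef n (Q : 'M[R]_n) : Prop :=
  Q^T = Q /\ forall v, v != 0 -> 0 < qform Q v.

Lemma qform_row_mx n (q : R) (Q : 'M[R]_n) (t : R) (v : 'rV[R]_n) :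
  @qform (1 + n) (block_mx q%:M 0 0 Q) (row_mx t%:M v) = q * t ^+ 2 + qform Q v.
Proof.
rewrite /qform mul_row_block !mulmx0 addr0 add0r tr_row_mx mul_row_col.
rewrite mxE tr_scalar_mx -!scalar_mxM mxE eqxx mulr1n.
by congr (_ + _); ring.
Qed.

Lemma sub_row_mx n (t c : R) (v w : 'rV[R]_n) :
  row_mx (t%:M : 'M[R]_1) v - row_mx c%:M w = row_mx (t - c)%:M (v - w).
Proof. by rewrite opp_row_mx add_row_mx raddfB. Qed.

Lemma posdef_drsubmx n (Q : 'M[R]_(1 + n)) : posdef Q -> posdef (drsubmx Q).
Proof.
move=> [Qs Qp]; split=> [|v v0]; first by rewrite trmx_drsub Qs.
have z0 : row_mx (0 : 'M[R]_1) v != 0 :> 'rV[R]_(1 + n).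
  apply: contra v0 => /eqP/(congr1 rsubmx); rewrite row_mxKr => ->.
  by apply/eqP/rowP => i; rewrite !mxE.
have := Qp _ z0; congr (_ < _); rewrite /qform -{1}(submxK Q) mul_row_block.
by rewrite !mul0mx !add0r tr_row_mx mul_row_col trmx0 mulmx0 add0r.
Qed.

(** Completing the square in the first coordinate; [q] is the Schur complement
    of [drsubmx Q]. *)
Lemma posdef_LDL n (Q : 'M[R]_(1 + n)) :
  posdef Q -> drsubmx Q \in unitmx ->
  exists q (A : 'rV[R]_n), let L := block_mx 1%:M A 0 1%:M : 'M[R]_(1 + n) in
    [/\ 0 < q, Q = L *m block_mx q%:M 0 0 (drsubmx Q) *m L^T,
        \det Q = q * \det (drsubmx Q) &
        forall t v, row_mx t%:M v *m L = row_mx t%:M (v + t *: A)].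
Proof.
move=> [Qs Qp]; set Q' := drsubmx Q => uQ'; set p := ursubmx Q.
have Q's : Q'^T = Q' by rewrite /Q' trmx_drsub Qs.
have pT : dlsubmx Q = p^T by rewrite /p trmx_ursub Qs.
have mulL (A : 'rV[R]_n) t v : row_mx t%:M v *m (block_mx 1%:M A 0 1%:M)
    = row_mx t%:M (v + t *: A) :> 'rV[R]_(1 + n).
  by rewrite mul_row_block !mulmx1 mulmx0 addr0 mul_scalar_mx addrC.
pose A := p *m invmx Q'; pose q := (ulsubmx Q - A *m p^T) 0 0.
have AQ : A *m Q' = p by rewrite /A mulmxKV.
have QE : Q = (block_mx 1%:M A 0 1%:M : 'M[R]_(1 + n)) *m
              block_mx q%:M 0 0 Q' *m (block_mx 1%:M A 0 1%:M)^T.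
  rewrite mulmx_block !(mul1mx, mul0mx, mulmx0, addr0, add0r).
  rewrite tr_block_mx !trmx1 trmx0 mulmx_block.
  rewrite !(mul1mx, mul0mx, mulmx0, mulmx1, addr0, add0r) AQ -[LHS]submxK.
  rewrite /q -mx11_scalar -[in RHS]AQ trmx_mul Q's mulmxA !AQ subrK.
  by have -> : Q' *m A^T = p^T by [rewrite -{1}Q's -trmx_mul AQ]; rewrite pT.
exists q, A; split => //.
- have z0 : row_mx (1%:M : 'M[R]_1) (- A) != 0 :> 'rV[R]_(1 + n).
    apply/eqP => /(congr1 lsubmx); rewrite row_mxKl => /matrixP/(_ 0 0).
    by rewrite !mxE eqxx => /eqP; rewrite oner_eq0.
  have := Qp _ z0; congr (_ < _); rewrite /qform {1}QE !mulmxA mulL.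
  rewrite -mulmxA -trmx_mul mulL scale1r addNr.
  have := qform_row_mx q Q' 1 0; rewrite /qform => ->.
  by rewrite mul0mx mul0mx mxE; ring.
- rewrite {1}QE !det_mulmx det_tr !det_ublock !det1 !mul1r mulr1.
  by rewrite det_scalar1.
Qed.

(** The volume integrates over one coordinate at a time, which matches completing
    the square: every section of an ellipsoid is an ellipsoid with the fixed matrix
    [drsubmx Q], and only its centre and size depend on [t]. *)
Lemma volume_ellipsoid n (Q : 'M[R]_n) : posdef Q ->
  0 < \det Q /\
  forall c s, volume [set v | qform Q (v - c) < s] =
    ((Num.sqrt (\det Q))^-1 * ball_vol n s)%:E.
Proof.
elim: n Q => [|n IH] Q Qp.
  rewrite det_mx00 sqrtr1 invr1; split=> [|c s]; first exact: ltr01.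
  rewrite mul1r -volume_sqball /=; congr ((nat_of_bool _)%:R%:E).
  by apply/idP/idP; rewrite !inE /sqball/= big_ord0 /qform mxE big_ord0.
have Q'p : posdef (drsubmx (Q : 'M[R]_(1 + n))).
  exact: posdef_drsubmx.
have [d'0 vol'] := IH _ Q'p.
have uQ' : drsubmx (Q : 'M[R]_(1 + n)) \in unitmx.
  by rewrite unitmxE unitfE lt0r_neq0.
have [q [A [q0 QE dE mulL]]] := posdef_LDL Qp uQ'.
have d0 : 0 < \det Q by rewrite dE mulr_gt0.
split=> // c s; rewrite [volume _]/=.
pose c1 := (c : 'rV[R]_(1 + n)) 0 (lshift n 0).
pose c' := rsubmx (c : 'rV[R]_(1 + n)).
set Q' := drsubmx (Q : 'M[R]_(1 + n)) in d'0 vol' QE dE.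
have cE : c = row_mx (c1%:M : 'M[R]_1) c' :> 'rV[R]_(1 + n).
  rewrite -[LHS](@hsubmxK _ 1 1 n); congr row_mx.
  by apply/rowP => i; rewrite ord1 !mxE eqxx mulr1n.
have qformE t v : qform Q (row_mx (t%:M : 'M[R]_1) v - c : 'rV[R]_(1 + n)) =
    q * (t - c1) ^+ 2 + qform Q' (v - (c' - (t - c1) *: A)).
  have -> : row_mx (t%:M : 'M[R]_1) v - c = row_mx (t - c1)%:M (v - c').
    by rewrite cE; exact: sub_row_mx.
  rewrite -qform_row_mx /qform {1}QE !mulmxA mulL -mulmxA -trmx_mul mulL.
  by rewrite opprB addrCA addrC.
have sect t :
    [set v | qform Q (row_mx (t%:M : 'M[R]_1) v - c : 'rV[R]_(1 + n)) < s] =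
    [set v | qform Q' (v - (c' - (t - c1) *: A)) < s - q * (t - c1) ^+ 2].
  by apply/seteqP; split => v /=; rewrite ltrBrDl -qformE.
pose r := Num.sqrt q.
have r0 : 0 < r by rewrite sqrtr_gt0.
have rr : r ^+ 2 = q by rewrite sqr_sqrtr// ltW.
(* The squared radius of the section is s - (r t - r c1) ^+ 2: an affine
   substitution turns this into the recursion for balls. *)
transitivity (\int[mu]_t ((Num.sqrt (\det Q'))^-1%:E *
    (ball_vol n (s - (r * t + (- r * c1)) ^+ 2)%R)%:E))%E.
  apply: eq_integral => t _.
  rewrite [X in volume X]sect vol' EFinM; congr (_ * (ball_vol n _)%:E)%E.
  by rewrite -rr; ring.
have mw := measurable_ndecr_subX2 s (@ball_vol_homo n).
rewrite ge0_integralZl//=; last 2 first.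
- exact: measurableT_comp mw (measurable_affine_map r (- r * c1)).
- by move=> t _; rewrite lee_fin ball_vol_ge0.
rewrite (ge0_integral_affine _ r0 mw); last first.
  by move=> t; rewrite lee_fin ball_vol_ge0.
rewrite -ball_volS -!EFinM dE sqrtrM ?(ltW q0)// -/r invfM; congr EFin; ring.
Qed.

End ellipsoid_volume.

(** * Randers norms on a Euclidean space *)

Section dot.
Context {R : realType} {n : nat}.
Implicit Types (u v w : 'rV[R]_n) (k : R).

Definition dot u v : R := (u *m v^T) 0 0.

Lemma dotE u v : dot u v = \sum_i u 0 i * v 0 i.
Proof. by rewrite /dot mxE; apply: eq_bigr => i _; rewrite mxE. Qed.
Lemma dotC u v : dot u v = dot v u.
Proof. by rewrite !dotE; apply: eq_bigr => i _; rewrite mulrC. Qed.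
Lemma dotDl u v w : dot (u + v) w = dot u w + dot v w.
Proof. by rewrite /dot mulmxDl mxE. Qed.
Lemma dotDr u v w : dot w (u + v) = dot w u + dot w v.
Proof. by rewrite !(dotC w) dotDl. Qed.
Lemma dotZl k u v : dot (k *: u) v = k * dot u v.
Proof. by rewrite /dot -scalemxAl mxE. Qed.
Lemma dotZr k u v : dot u (k *: v) = k * dot u v.
Proof. by rewrite !(dotC u) dotZl. Qed.
Lemma dotNl u v : dot (- u) v = - dot u v.
Proof. by rewrite -scaleN1r dotZl mulN1r. Qed.
Lemma dotNr u v : dot u (- v) = - dot u v.
Proof. by rewrite -scaleN1r dotZr mulN1r. Qed.
Lemma dot0l u : dot 0 u = 0. Proof. by rewrite /dot mul0mx mxE. Qed.
Lemma dot0r u : dot u 0 = 0. Proof. by rewrite dotC dot0l. Qed.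
Lemma dot_suml (I : finType) (f : I -> 'rV[R]_n) u :
  dot (\sum_i f i) u = \sum_i dot (f i) u.
Proof. by rewrite /dot mulmx_suml summxE. Qed.
Lemma dot_sumr (I : finType) (f : I -> 'rV[R]_n) u :
  dot u (\sum_i f i) = \sum_i dot u (f i).
Proof. by rewrite dotC dot_suml; apply: eq_bigr => i _; rewrite dotC. Qed.
Lemma dot_ge0 u : 0 <= dot u u.
Proof. by rewrite dotE sumr_ge0// => i _; rewrite -expr2 sqr_ge0. Qed.
Lemma dot_eq0 u : (dot u u == 0) = (u == 0).
Proof.
apply/eqP/eqP => [|->]; last exact: dot0l.
rewrite dotE => h; apply/rowP => i; rewrite mxE; apply/eqP.
rewrite -sqrf_eq0 expr2; apply/eqP; move: i isT; apply: psumr_eq0P h => i _.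
by rewrite -expr2 sqr_ge0.
Qed.
Lemma dot_gt0 u : u != 0 -> 0 < dot u u.
Proof. by rewrite lt0r dot_eq0 dot_ge0 andbT. Qed.

(** Unlike the Cauchy-Schwarz inequality, this identity also settles the case of
    equality, which is what the definiteness of the Hessian requires. *)
Lemma lagrange_identity u v : let w := dot v v *: u - dot u v *: v in
  dot w w = dot v v * (dot u u * dot v v - dot u v ^+ 2).
Proof.
rewrite /= !(dotDl, dotDr, dotNl, dotNr, dotZl, dotZr) (dotC v u); ring.
Qed.

Lemma cauchy_schwarz u v : dot u v ^+ 2 <= dot u u * dot v v.
Proof.
have [->|v0] := eqVneq v 0; first by rewrite !dot0r mulr0 expr0n.
have := dot_ge0 (dot v v *: u - dot u v *: v).
by rewrite lagrange_identity pmulr_rge0 ?dot_gt0// subr_ge0.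
Qed.

Definition nrm u := Num.sqrt (dot u u).

Lemma nrm_ge0 u : 0 <= nrm u. Proof. exact: sqrtr_ge0. Qed.
Lemma nrm_gt0 u : u != 0 -> 0 < nrm u.
Proof. by move=> /dot_gt0; rewrite sqrtr_gt0. Qed.
Lemma nrm_sqr u : nrm u ^+ 2 = dot u u. Proof. by rewrite sqr_sqrtr ?dot_ge0. Qed.

Lemma dot_le u v : `|dot u v| <= nrm u * nrm v.
Proof.
rewrite -(@ler_pXn2r _ 2)// ?nnegrE ?mulr_ge0 ?nrm_ge0//.
by rewrite exprMn !nrm_sqr real_normK ?num_real// cauchy_schwarz.
Qed.

Variable lam : 'rV[R]_n.

Definition rnorm v := nrm v + dot lam v.

Hypothesis lam1 : dot lam lam < 1.

Lemma dot_lt_nrm v : v != 0 -> `|dot lam v| < nrm v.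
Proof.
move=> v0; apply: le_lt_trans (dot_le _ _) _.
rewrite gtr_pMl ?nrm_gt0// /nrm -sqrtr1 ltr_sqrt//.
Qed.

Lemma rnorm_gt0 v : v != 0 -> 0 < rnorm v.
Proof.
by move=> /dot_lt_nrm; rewrite ltr_norml => /andP[h _]; rewrite /rnorm; lra.
Qed.

(** The quadratic part of the equation of the indicatrix, obtained by squaring
    |v| < 1 - <lam, v>. *)
Definition indicatrix_form : 'M[R]_n := 1%:M - lam^T *m lam.

Lemma qform_indicatrix_form v : qform indicatrix_form v = dot v v - dot lam v ^+ 2.
Proof.
rewrite /qform /indicatrix_form mulmxBr mulmx1 mulmxBl mulmxA -(mulmxA (v *m lam^T)).
rewrite mxE [X in _ + X]mxE [X in - X]mxE big_ord1.
by rewrite -!/(dot _ _) (dotC v lam) expr2.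
Qed.

Lemma posdef_indicatrix_form : posdef indicatrix_form.
Proof.
split=> [|v v0]; first by rewrite /indicatrix_form linearB/= trmx1 trmx_mul trmxK.
rewrite qform_indicatrix_form subr_gt0 -nrm_sqr -real_normK ?num_real//.
by rewrite ltr_pXn2r ?nnegrE ?normr_ge0 ?nrm_ge0 ?dot_lt_nrm.
Qed.

Let r := (1 - dot lam lam)^-1.

(** Squaring loses nothing: |<lam, v>| < |v| rules out the branch
    1 - <lam, v> <= - |v|. The centre is found by completing the square. *)
Lemma indicatrix_ellipsoid v :
  (rnorm v < 1) = (qform indicatrix_form (v + r *: lam) < r).
Proof.
have l0 : 1 - dot lam lam != 0 by rewrite gt_eqF// subr_gt0.
have rE : dot lam lam = 1 - r^-1 by rewrite /r invrK; ring.
have r0 : 0 < r by rewrite invr_gt0 subr_gt0.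
have -> : qform indicatrix_form (v + r *: lam) =
    dot v v - dot lam v ^+ 2 + 2 * dot lam v + r - 1.
  rewrite qform_indicatrix_form !(dotDl, dotDr, dotZl, dotZr) (dotC v lam) rE.
  by field; rewrite gt_eqF.
rewrite /rnorm -nrm_sqr.
have [->|v0] := eqVneq v 0.
  by rewrite /nrm dot0l dot0r sqrtr0; apply/idP/idP => _; lra.
have := dot_lt_nrm v0; rewrite ltr_norml => /andP[h1 h2].
have := nrm_gt0 v0.
set a := nrm v; set b := dot lam v; rewrite -/a -/b in h1 h2 * => a0.
have -> : (a ^+ 2 - b ^+ 2 + 2 * b + r - 1 < r) = ((a + b - 1) * (a - b + 1) < 0).
  by apply/idP/idP; lra.
rewrite pmulr_llt0 ?subr_lt0//; lra.
Qed.

Definition indicatrix_const : R :=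
  (Num.sqrt (\det indicatrix_form))^-1 * ball_vol n r.

Lemma indicatrix_const_gt0 : 0 < indicatrix_const.
Proof.
rewrite mulr_gt0// ?ball_vol_gt0 ?invr_gt0 ?subr_gt0//.
by rewrite sqrtr_gt0; have [] := volume_ellipsoid posdef_indicatrix_form.
Qed.

Lemma volume_indicatrix (N : 'M[R]_n) : N \in unitmx ->
  volume [set y | rnorm (y *m N) < 1] = (`|\det N|^-1 * indicatrix_const)%:E.
Proof.
move=> uN; pose Q := N *m indicatrix_form *m N^T.
have qformE y : qform Q y = qform indicatrix_form (y *m N).
  by rewrite /qform /Q trmx_mul !mulmxA.
have Qp : posdef Q.
  have [S P] := posdef_indicatrix_form; split => [|v v0].
    by rewrite /Q !trmx_mul trmxK S mulmxA.
  rewrite qformE P//; apply: contra v0 => /eqP h.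
  by rewrite -(mulmxK uN v) h mul0mx.
have [_ vol] := volume_ellipsoid Qp.
rewrite [X in volume X](_ : _ =
    [set y | qform Q (y - (- r *: (lam *m invmx N))) < r]); last first.
  apply/seteqP; split=> y /=;
  rewrite qformE scaleNr opprK mulmxDl -scalemxAl mulmxKV//;
  by rewrite indicatrix_ellipsoid.
rewrite vol /Q !det_mulmx det_tr mulrAC -expr2 sqrtrM ?sqr_ge0// sqrtr_sqr.
by rewrite invfM /indicatrix_const mulrA.
Qed.

End dot.

(** * Directional derivatives of matrix valued maps *)

Section is_derive_complements.
Context {R : realType} {V : normedModType R}.
Implicit Types (x d : V).

Lemma is_derive_line (W : normedModType R) (f : V -> W) x d df :
  is_derive x d f df <-> is_derive (0 : R) 1 (fun h => f (h *: d + x)) df.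
Proof.
have E : 'D_d f x = 'D_1 (fun h : R => f (h *: d + x)) 0.
  rewrite /derive; set g1 := fun h => h^-1 *: _; set g2 := fun h => h^-1 *: _.
  suff -> : g1 = g2 by [].
  by rewrite funeqE /g1 /g2 => h /=; rewrite addr0 scale0r add0r [_%:A]mulr1.
split=> -[h <-].
  by apply: DeriveDef; rewrite -?E//; have /derivable1P := h.
by apply: DeriveDef; rewrite ?E//; apply/derivable1P.
Qed.

(** A directional derivative is a derivative in one real variable along a line,
    so that the one-variable chain rule applies without assuming [f]
    differentiable. *)
Lemma is_derive_chain (f : V -> R) (g : R -> R) x d df dg :
  is_derive x d f df -> is_derive (f x) 1 g dg ->
  is_derive x d (g \o f) (dg * df).
Proof.
move=> /is_derive_line hf hg; apply/is_derive_line.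
apply: (@is_derive1_comp _ g (fun h => f (h *: d + x))).
by rewrite scale0r add0r.
Qed.

Lemma is_derive_lin (W : normedModType R) (f : V -> W) x d :
  (forall k u v, f (k *: u + v) = k *: f u + f v) -> is_derive x d f (f d).
Proof.
move=> lf.
have E : (fun h : R => h^-1 *: ((f \o shift x) (h *: d) - f x)) @ 0^' --> f d.
  apply: cvg_near_cst; near=> h => /=.
  rewrite lf addrK scalerA mulVf ?scale1r//.
  by near: h; exact: nbhs_dnbhs_neq.
by apply: DeriveDef; [apply/cvg_ex; exists (f d)|exact: cvg_lim E].
Unshelve. all: by end_near. Qed.

Lemma is_derive_mxP m n (M : V -> 'M[R]_(m, n)) x d dM :
  is_derive x d M dM <-> forall i j, is_derive x d (fun z => M z i j) (dM i j).
Proof.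
split=> [[/[dup] hM /derivable_mxP h <-] i j|h].
  by rewrite derive_mx// mxE; apply: derivableP.
have hM : derivable M x d by apply/derivable_mxP => i j; have [] := h i j.
apply: DeriveDef => //; rewrite derive_mx//; apply/matrixP => i j; rewrite mxE.
exact: derive_val.
Qed.

Lemma is_derive_bigsum n (f : 'I_n -> V -> R) x d (df : 'I_n -> R) :
  (forall i, is_derive x d (f i) (df i)) ->
  is_derive x d (fun z => \sum_i f i z) (\sum_i df i).
Proof.
move=> h; have := @is_derive_sum _ _ _ _ f x d df h.
by rewrite (_ : \sum_i f i = fun z => \sum_i f i z)// funeqE => z; rewrite fct_sumE.
Qed.

Lemma is_derive_mul (f g : V -> R) x d df dg :
  is_derive x d f df -> is_derive x d g dg ->
  is_derive x d (fun z => f z * g z) (df * g x + f x * dg).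
Proof.
move=> hf hg; have h := is_deriveM hf hg.
have -> : df * g x + f x * dg = f x *: dg + g x *: df.
  by rewrite addrC [df * _]mulrC.
exact: h.
Qed.

Lemma is_derive_add (f g : V -> R) x d df dg :
  is_derive x d f df -> is_derive x d g dg ->
  is_derive x d (fun z => f z + g z) (df + dg).
Proof. by move=> hf hg; exact: is_deriveD. Qed.

Lemma is_derive_mulmx m n q (M : V -> 'M[R]_(m, n)) (N : V -> 'M[R]_(n, q))
    x d dM dN :
  is_derive x d M dM -> is_derive x d N dN ->
  is_derive x d (fun z => M z *m N z) (dM *m N x + M x *m dN).
Proof.
move=> /is_derive_mxP hM /is_derive_mxP hN; apply/is_derive_mxP => i j.
rewrite [X in is_derive _ _ X](_ : _ =
  fun z => \sum_k (M z i k * N z k j)); last first.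
  by rewrite funeqE => z; rewrite mxE.
rewrite !mxE -big_split/=; apply: is_derive_bigsum => k.
exact: is_derive_mul.
Qed.

Lemma is_derive_scale m n (f : V -> R) (M : V -> 'M[R]_(m, n)) x d df dM :
  is_derive x d f df -> is_derive x d M dM ->
  is_derive x d (fun z => f z *: M z) (df *: M x + f x *: dM).
Proof.
move=> hf /is_derive_mxP hM; apply/is_derive_mxP => i j; rewrite !mxE.
rewrite (_ : (fun z => _) = fun z => f z * M z i j); last first.
  by rewrite funeqE => z; rewrite mxE.
exact: is_derive_mul.
Qed.

Lemma is_derive_dot n (u v : V -> 'rV[R]_n) x d du dv :
  is_derive x d u du -> is_derive x d v dv ->
  is_derive x d (fun z => dot (u z) (v z)) (dot du (v x) + dot (u x) dv).
Proof.
move=> hu /is_derive_mxP hv.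
have hvT : is_derive x d (fun z => (v z)^T) dv^T.
  apply/is_derive_mxP => i j; rewrite mxE.
  by rewrite (_ : (fun z => _) = fun z => v z j i)// funeqE => z; rewrite mxE.
have /is_derive_mxP/(_ 0 0) := is_derive_mulmx hu hvT.
by rewrite mxE.
Qed.

Lemma is_derive_nrm n (v : V -> 'rV[R]_n) x d dv :
  is_derive x d v dv -> v x != 0 ->
  is_derive x d (fun z => nrm (v z)) (dot (v x) dv / nrm (v x)).
Proof.
move=> hv v0; have hd := is_derive_dot hv hv.
have hs := @is_derive1_sqrt R _ (dot_gt0 v0).
apply: is_derive_eq; first exact: is_derive_chain hd hs.
rewrite -/(nrm (v x)) (dotC dv); field.
by rewrite gt_eqF ?nrm_gt0.
Qed.

End is_derive_complements.

Section jacobi.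
Context {R : realType} {V : normedModType R} (x d : V).

Lemma is_derive_prod n (f : 'I_n -> V -> R) (df : 'I_n -> R) :
  (forall i, is_derive x d (f i) (df i)) ->
  is_derive x d (fun z => \prod_i f i z)
    (\sum_i df i * \prod_(j | j != i) f j x).
Proof.
elim: n f df => [|n IH] f df hf.
  rewrite big_ord0; under eq_fun do rewrite big_ord0.
  exact: is_derive_cst.
under eq_fun do rewrite big_ord_recl.
have := is_derive_mul (hf ord0) (IH _ _ (fun i => hf (lift ord0 i))).
move/is_derive_eq; apply; rewrite [RHS]big_ord_recl.
rewrite [X in df ord0 * X + _ = _](_ : _ = \prod_(j | j != ord0) f j x); last first.
  by rewrite [RHS]big_mkcond big_ord_recl/= mul1r.
congr (_ + _); rewrite mulr_sumr; apply: eq_bigr => i _.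
rewrite [in RHS]big_mkcond big_ord_recl/= mulrCA.
congr (_ * (_ * _)); rewrite big_mkcond; apply: eq_bigr => j _.
by rewrite (inj_eq lift_inj).
Qed.

(** Jacobi's formula: by multilinearity the derivative is the sum over [i] of the
    determinants with row [i] differentiated, each expanded along that row. *)
Lemma is_derive_det n (M : V -> 'M[R]_n) dM :
  is_derive x d M dM ->
  is_derive x d (fun z => \det (M z)) (\tr (dM *m \adj (M x))).
Proof.
move=> /is_derive_mxP hM.
have h (s : 'S_n) := is_derive_mul (is_derive_cst ((-1) ^+ s : R) x d)
  (is_derive_prod (fun i => hM i (s i))).
pose D i := \matrix_(k, l) (if k == i then dM k l else M x k l).
have -> : \tr (dM *m \adj (M x)) = \sum_i \det (D i).
  apply: eq_bigr => i _; rewrite mxE (expand_det_row _ i).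
  apply: eq_bigr => j _; rewrite !mxE eqxx; congr (_ * _).
  rewrite /cofactor; congr (_ * \det _); apply/matrixP => k l.
  by rewrite !mxE eq_sym (negPf (neq_lift _ _)).
have -> : \sum_i \det (D i) = \sum_(s : 'S_n)
    ((-1) ^+ s * \sum_i (dM i (s i) * \prod_(j | j != i) M x j (s j))).
  rewrite exchange_big; apply: eq_bigr => s _ /=.
  rewrite mulr_sumr; apply: eq_bigr => i _; congr (_ * _).
  rewrite (bigD1 i)//= mxE eqxx; congr (_ * _).
  by apply: eq_bigr => j ji; rewrite mxE (negPf ji).
have sumP (I : Type) (r : seq I) (f : I -> V -> R) (df : I -> R) :
    (forall i, is_derive x d (f i) (df i)) ->
    is_derive x d (fun z => \sum_(i <- r) f i z) (\sum_(i <- r) df i).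
  move=> hf; elim: r => [|i r IH].
    by rewrite big_nil; under eq_fun do rewrite big_nil; exact: is_derive_cst.
  by rewrite big_cons; under eq_fun do rewrite big_cons; exact: is_derive_add.
apply: sumP => s; refine (is_derive_eq (h s) _).
by rewrite mul0r add0r.
Qed.

End jacobi.

(** * First and second differentials of the energy of a Randers norm *)

Section rnorm_derivatives.
Context {R : realType} {n : nat} (lam : 'rV[R]_n).
Implicit Types (v w a u : 'rV[R]_n).

(** Explicit differentials at [v]: the first one of the Randers norm, and the
    first and second ones of its square, the energy. *)
Definition drnorm v w := dot v w / nrm v + dot lam w.
Definition denergy v w := 2 * rnorm lam v * drnorm v w.
Definition hess_energy v a u := 2 * drnorm v a * drnorm v u +
  2 * rnorm lam v * (dot a u / nrm v - dot v a * dot v u / nrm v ^+ 3).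

Section curves.
Context {V : normedModType R} (x d : V) (v u : V -> 'rV[R]_n) (dv du : 'rV[R]_n).
Hypotheses (hv : is_derive x d v dv) (hu : is_derive x d u du) (v0 : v x != 0).

Lemma is_derive_rnorm :
  is_derive x d (fun z => rnorm lam (v z)) (drnorm (v x) dv).
Proof.
apply: is_derive_eq.
  apply: is_derive_add (is_derive_nrm hv v0) _.
  exact: (is_derive_dot (is_derive_cst lam x d) hv).
by rewrite /drnorm dot0l add0r.
Qed.

Lemma is_derive_energy :
  is_derive x d (fun z => rnorm lam (v z) ^+ 2) (denergy (v x) dv).
Proof.
apply: is_derive_eq.
  exact: is_derive_mul is_derive_rnorm is_derive_rnorm.
by rewrite /denergy; ring.
Qed.

Lemma is_derive_drnorm : is_derive x d (fun z => drnorm (v z) (u z))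
  (dot dv (u x) / nrm (v x) - dot (v x) dv * dot (v x) (u x) / nrm (v x) ^+ 3
   + drnorm (v x) du).
Proof.
have n0 : nrm (v x) != 0 by rewrite gt_eqF ?nrm_gt0.
have hi := @is_deriveV R id (nrm (v x)) 1 1 n0 (is_derive_id _ _).
have hV := is_derive_chain (is_derive_nrm hv v0) hi.
have h1 := is_derive_mul (is_derive_dot hv hu) hV.
have h2 := is_derive_dot (is_derive_cst lam x d) hu.
refine (is_derive_eq (is_derive_add h1 h2) _).
by rewrite /drnorm dot0l add0r /GRing.scale/=; field.
Qed.

Lemma is_derive_denergy : is_derive x d (fun z => denergy (v z) (u z))
  (hess_energy (v x) dv (u x) + denergy (v x) du).
Proof.
have h1 := is_derive_mul (is_derive_cst (2 : R) x d) is_derive_rnorm.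
refine (is_derive_eq (is_derive_mul h1 is_derive_drnorm) _).
by rewrite /hess_energy /denergy; ring.
Qed.

End curves.
End rnorm_derivatives.

Section hessian.
Context {R : realType} {n : nat} (lam : 'rV[R]_n).
Implicit Types (u v w a : 'rV[R]_n) (k : R).

Lemma drnorm_lin v k u w :
  drnorm lam v (k *: u + w) = k * drnorm lam v u + drnorm lam v w.
Proof. by rewrite /drnorm !(dotDr, dotZr); ring. Qed.

Lemma denergy_lin v k u w :
  denergy lam v (k *: u + w) = k * denergy lam v u + denergy lam v w.
Proof. by rewrite /denergy drnorm_lin; ring. Qed.

Lemma hess_energyC v a u : hess_energy lam v a u = hess_energy lam v u a.
Proof. by rewrite /hess_energy (dotC a u); ring. Qed.

Lemma hess_energy_lin v a k u w :
  hess_energy lam v a (k *: u + w) =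
  k * hess_energy lam v a u + hess_energy lam v a w.
Proof. by rewrite /hess_energy drnorm_lin !(dotDr, dotZr); ring. Qed.

Lemma drnorm_euler v : v != 0 -> drnorm lam v v = rnorm lam v.
Proof.
by move=> /nrm_gt0 v0; rewrite /drnorm /rnorm -nrm_sqr expr2 mulfK ?gt_eqF.
Qed.

Lemma hess_energy_euler v w : v != 0 ->
  hess_energy lam v v w = 2 * rnorm lam v * drnorm lam v w.
Proof.
move=> v0; rewrite /hess_energy drnorm_euler// -nrm_sqr.
by field; rewrite gt_eqF ?nrm_gt0.
Qed.

Hypothesis lam1 : dot lam lam < 1.

(** The Hessian is the sum of 2 (df(a))^2 and of a positive multiple of the
    Cauchy-Schwarz defect of [a] and [v]. If it vanishes then [a] is a multiple
    of [v], on which df is not zero by Euler's relation. *)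
Lemma hess_energy_definite v a : v != 0 -> hess_energy lam v a a = 0 -> a = 0.
Proof.
move=> v0 h; have n0 := nrm_gt0 v0; have f0 := rnorm_gt0 lam1 v0.
pose w := dot v v *: a - dot a v *: v.
have E : hess_energy lam v a a =
    2 * drnorm lam v a ^+ 2 + 2 * rnorm lam v / nrm v ^+ 5 * dot w w.
  rewrite /w lagrange_identity (dotC a v) -nrm_sqr /hess_energy; field.
  by rewrite gt_eqF.
have w0 := dot_ge0 w.
have c0 : 0 < 2 * rnorm lam v / nrm v ^+ 5.
  by rewrite !mulr_gt0// invr_gt0 exprn_gt0.
have F2 := sqr_ge0 (drnorm lam v a).
have cw : 0 <= 2 * rnorm lam v / nrm v ^+ 5 * dot w w by rewrite mulr_ge0// ltW.
have F0 : drnorm lam v a ^+ 2 = 0 by lra.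
have /eqP : 2 * rnorm lam v / nrm v ^+ 5 * dot w w = 0 by lra.
rewrite mulf_eq0 gt_eqF//= dot_eq0 subr_eq0 => /eqP av.
move/eqP: F0; rewrite sqrf_eq0 => /eqP F0.
have vv := dot_gt0 v0.
have aE : a = (dot a v / dot v v) *: v.
  by rewrite mulrC -scalerA -av scalerA mulVf ?scale1r ?gt_eqF.
have : drnorm lam v a = (dot a v / dot v v) * rnorm lam v.
  have := drnorm_lin v (dot a v / dot v v) v 0.
  by rewrite addr0 -aE drnorm_euler// => ->; rewrite /drnorm !dot0r; ring.
rewrite F0 => /esym/eqP; rewrite mulf_eq0 (gt_eqF f0) orbF => /eqP k0.
by rewrite aE k0 scale0r.
Qed.

End hessian.

(** * Lie brackets and the Euler-Arnold equation *)

Lemma lin_sum (R : pzRingType) (V W : lmodType R) (f : V -> W) (I : Type)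
    (r : seq I) (a : I -> R) (u : I -> V) :
  (forall k u v, f (k *: u + v) = k *: f u + f v) ->
  f (\sum_(i <- r) a i *: u i) = \sum_(i <- r) a i *: f (u i).
Proof.
move=> lf; have f0 : f 0 = 0.
  have := lf 1 0 0; rewrite !scale1r addr0 => /(congr1 (fun z => z - f 0)).
  by rewrite addrK subrr.
by elim/big_rec2: _ => // i y1 y2 _ <-; rewrite lf.
Qed.

Lemma lin_delta (R : realType) n (W : lmodType R) (f : 'rV[R]_n -> W) :
  (forall k u v, f (k *: u + v) = k *: f u + f v) ->
  forall w, f w = \sum_k w 0 k *: f (delta_mx 0 k).
Proof. by move=> lf w; rewrite {1}(row_sum_delta w) lin_sum. Qed.

Section bracket.
Context {R : realType} {n : nat} (c : 'I_n -> 'I_n -> 'rV[R]_n).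
Implicit Types (u v w : 'rV[R]_n) (k : R).

Definition lie_bracket u v : 'rV[R]_n := \sum_i \sum_j (u 0 i * v 0 j) *: c i j.

Lemma lie_bracket_linl k u v w :
  lie_bracket (k *: u + v) w = k *: lie_bracket u w + lie_bracket v w.
Proof.
rewrite /lie_bracket scaler_sumr -big_split; apply: eq_bigr => i _ /=.
rewrite scaler_sumr -big_split; apply: eq_bigr => j _ /=.
by rewrite !mxE scalerA -scalerDl; congr (_ *: _); ring.
Qed.

Hypothesis c_anti : forall i j, c i j = - c j i.

Lemma lie_bracket_anti u v : lie_bracket u v = - lie_bracket v u.
Proof.
rewrite /lie_bracket exchange_big -sumrN; apply: eq_bigr => j _; rewrite -sumrN.
by apply: eq_bigr => i _; rewrite c_anti scalerN mulrC.
Qed.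

Lemma lie_bracket_alt u : lie_bracket u u = 0.
Proof.
have /rowP h := lie_bracket_anti u u; apply/rowP => j.
by have := h j; rewrite !mxE; lra.
Qed.

Lemma lie_bracket_delta u (k : 'I_n) :
  lie_bracket u (delta_mx 0 k) = \sum_i u 0 i *: c i k.
Proof.
apply: eq_bigr => i _; rewrite (bigD1 k)//= mxE !eqxx mulr1 big1 ?addr0// => j jk.
by rewrite mxE eqxx (negPf jk) mulr0 scale0r.
Qed.

Definition ad u : 'M[R]_n := \matrix_k lie_bracket u (delta_mx 0 k).

Lemma mul_ad u w : w *m ad u = lie_bracket u w.
Proof.
rewrite mulmx_sum_row.
under eq_bigr do rewrite rowK lie_bracket_delta scaler_sumr.
rewrite exchange_big; apply: eq_bigr => i _; apply: eq_bigr => j _ /=.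
by rewrite scalerA mulrC.
Qed.

Lemma tr_ad u : (forall i, \sum_k c i k 0 k = 0) -> \tr (ad u) = 0.
Proof.
move=> h; rewrite /mxtrace.
under eq_bigr do rewrite mxE lie_bracket_delta summxE.
rewrite exchange_big big1// => i _ /=.
by under eq_bigr do rewrite mxE; rewrite -mulr_sumr h mulr0.
Qed.

Lemma dot_lie_bracket lam u v :
  (forall i j, dot lam (c i j) = 0) -> dot lam (lie_bracket u v) = 0.
Proof.
move=> h; rewrite /lie_bracket dot_sumr big1// => i _; rewrite dot_sumr big1// => j _.
by rewrite dotZr h mulr0.
Qed.

Variable lam : 'rV[R]_n.

(** Twice the nonlinear part of the Riemannian spray: the transpose of [ad]
    encodes <Z_0(v), w> = - <v, [v, w]>. *)
Definition riem_acc v : 'rV[R]_n := - (v *m (ad v)^T).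
Definition randers_acc v : 'rV[R]_n :=
  riem_acc v + (dot v (lie_bracket v lam) / rnorm lam v) *: v.

Lemma dot_riem_acc v w : dot (riem_acc v) w = - dot v (lie_bracket v w).
Proof. by rewrite dotNl -(mul_ad v w) /dot -mulmxA -trmx_mul. Qed.

Hypothesis lam1 : dot lam lam < 1.
Hypothesis lam_orth : forall i j, dot lam (c i j) = 0.

(** The Riemannian vector fails the Randers equation only by a multiple of df,
    because [lam] is orthogonal to all brackets but <lam, Z_0(v)> =
    - <v, [v, lam]>; by Euler's relation the Hessian at the radial vector [v] is a
    multiple of df as well, which gives the correction term. *)
Lemma euler_arnold v w : v != 0 ->
  hess_energy lam v (randers_acc v) w = - denergy lam v (lie_bracket v w).
Proof.
move=> v0; have n0 := nrm_gt0 v0; have f0 := rnorm_gt0 lam1 v0.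
rewrite hess_energyC /randers_acc addrC hess_energy_lin !(hess_energyC _ _ w).
rewrite hess_energy_euler// [hess_energy _ _ (riem_acc v) w]/hess_energy.
rewrite dot_riem_acc [drnorm lam v (riem_acc v)]/drnorm.
rewrite (dotC v (riem_acc v)) (dotC lam (riem_acc v)) !dot_riem_acc.
rewrite lie_bracket_alt dot0r.
rewrite /denergy [drnorm lam v (lie_bracket v w)]/drnorm.
rewrite (dot_lie_bracket _ _ lam_orth).
by field; rewrite !gt_eqF.
Qed.

Lemma ad_lin k u v : ad (k *: u + v) = k *: ad u + ad v.
Proof. by apply/row_matrixP => i; rewrite linearP/= !rowK lie_bracket_linl. Qed.

(** The differential of [riem_acc] at [v], as a matrix acting on the right. *)
Definition driem_acc v : 'M[R]_n :=
  - ((ad v)^T + \matrix_k (v *m (ad (delta_mx 0 k))^T)).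

Lemma mul_driem_acc v w : w *m driem_acc v = - (w *m (ad v)^T + v *m (ad w)^T).
Proof.
rewrite /driem_acc mulmxN mulmxDr; congr (- (_ + _)).
rewrite mulmx_sum_row; under eq_bigr do rewrite rowK.
rewrite (lin_delta (ad_lin) w) linear_sum/= mulmx_sumr; apply: eq_bigr => k _.
by rewrite linearZ/= -scalemxAr.
Qed.

Lemma tr_driem_acc v : (forall i, \sum_k c i k 0 k = 0) -> \tr (driem_acc v) = 0.
Proof.
move=> h; rewrite /driem_acc linearN linearD/= mxtrace_tr tr_ad// add0r.
rewrite /mxtrace big1 ?oppr0// => k _; rewrite mxE mxE big1// => j _.
by rewrite !mxE lie_bracket_alt mxE mulr0.
Qed.

End bracket.

(** * Spray and S-curvature in a left invariant coframe *)

Section left_invariant_spray.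
Context {R : realType} {T : topologicalType} {n : nat}.
Variables (p : chart R T n) (F : @tfunction R T n) (lam : 'rV[R]_n).
Variables (c : 'I_n -> 'I_n -> 'rV[R]_n).
Variables (x0 : 'rV[R]_n) (N : 'rV[R]_n -> 'M[R]_n) (Nd : 'I_n -> 'M[R]_n)
  (M : 'M[R]_n).
Local Notation e i := (delta_mx 0 i : 'rV[R]_n).
Local Notation N0 := (N x0).

Definition Dcoframe (y : 'rV[R]_n) : 'M[R]_n := \sum_m y 0 m *: Nd m.
Local Notation D := Dcoframe.

Hypothesis lam1 : dot lam lam < 1.
Hypothesis c_anti : forall i j, c i j = - c j i.
Hypothesis lam_orth : forall i j, dot lam (c i j) = 0.
Hypothesis unimod : forall i, \sum_k c i k 0 k = 0.
Hypothesis hN : forall m, is_derive x0 (e m) N (Nd m).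
Hypothesis MN : M *m N0 = 1%:M.
Hypothesis hNu : \forall x \near x0, N x \in unitmx.
Hypothesis hF : \forall x \near x0, forall y, F p x y = rnorm lam (y *m N x).
Hypothesis maurer_cartan : forall y z,
  z *m D y - y *m D z = - lie_bracket c (y *m N0) (z *m N0).

Lemma partial_is_derive (f : 'rV[R]_n -> R) i x df :
  is_derive x (e i) f df -> partial i f x = df.
Proof. by move=> [_ <-]. Qed.

Lemma near_partial (f g : 'rV[R]_n -> R) i x df :
  (\forall z \near x, g z = f z) -> is_derive x (e i) g df -> partial i f x = df.
Proof. by move=> fg h; apply/partial_is_derive; apply: near_eq_is_derive h. Qed.

Lemma near_neq0 (y : 'rV[R]_n) : y != 0 -> \forall z \near y, z != 0.
Proof.
by move=> y0; apply: (@cvgr_neq0 _ _ _ (nbhs y) _ id y) => //; exact: cvg_id.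
Qed.

Lemma NM : N0 *m M = 1%:M. Proof. exact: mulmx1C MN. Qed.

Lemma mulN_neq0 (y : 'rV[R]_n) : y != 0 -> y *m N0 != 0.
Proof.
by apply: contra => /eqP h; rewrite -[y]mulmx1 -NM mulmxA h mul0mx.
Qed.

Lemma F_at y : F p x0 y = rnorm lam (y *m N0).
Proof. exact: (nbhs_singleton hF). Qed.

Lemma is_derive_mulN (y d : 'rV[R]_n) (A : 'M[R]_n) :
  is_derive y d (fun z => z *m A) (d *m A).
Proof. by apply: is_derive_lin => k u v; rewrite mulmxDl -scalemxAl. Qed.

Lemma is_derive_N (y : 'rV[R]_n) m :
  is_derive x0 (e m) (fun x => y *m N x) (y *m Nd m).
Proof.
apply: is_derive_eq (is_derive_mulmx (is_derive_cst y x0 (e m)) (hN m)) _.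
by rewrite mul0mx add0r.
Qed.

Lemma partial_x y m : y != 0 ->
  partial m (fun x => F p x y ^+ 2) x0 = denergy lam (y *m N0) (y *m Nd m).
Proof.
move=> y0; apply: (@near_partial _ (fun x => rnorm lam (y *m N x) ^+ 2)).
  by near=> x; rewrite (near hF x).
exact: (is_derive_energy lam (is_derive_N y m) (mulN_neq0 y0)).
Unshelve. all: by end_near. Qed.

Lemma partial_yx y m l : y != 0 ->
  partial l (fun y' => partial m (fun x => F p x y' ^+ 2) x0) y =
  hess_energy lam (y *m N0) (e l *m N0) (y *m Nd m)
  + denergy lam (y *m N0) (e l *m Nd m).
Proof.
move=> y0; apply: (@near_partial _ (fun y => denergy lam (y *m N0) (y *m Nd m))).
  by near=> z; rewrite partial_x//; near: z; exact: near_neq0.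
exact: (is_derive_denergy lam (is_derive_mulN _ _ _) (is_derive_mulN _ _ _)
  (mulN_neq0 y0)).
Unshelve. all: by end_near. Qed.

Lemma fundamental_tensorE y i j : y != 0 ->
  fundamental_tensor F p x0 y i j =
  2^-1 * hess_energy lam (y *m N0) (e i *m N0) (e j *m N0).
Proof.
move=> y0; rewrite mxE; congr (_ * _).
apply: (@near_partial _ (fun y => denergy lam (y *m N0) (e j *m N0))).
  near=> z; apply/esym; apply: (@near_partial _ (fun z => rnorm lam (z *m N0) ^+ 2)).
    by near=> w; rewrite F_at.
  have z0 : z != 0 by near: z; exact: near_neq0.
  exact: (is_derive_energy lam (is_derive_mulN _ _ _) (mulN_neq0 z0)).
have h := is_derive_denergy lam (is_derive_mulN y (e i) N0)
  (is_derive_cst (e j *m N0) y (e i)) (mulN_neq0 y0).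
refine (is_derive_eq h _).
by rewrite [denergy _ _ 0]/denergy /drnorm !dot0r; ring.
Unshelve. all: by end_near. Qed.

Lemma fundamental_tensor_unit y : y != 0 -> fundamental_tensor F p x0 y \in unitmx.
Proof.
move=> y0; rewrite -row_free_unit; apply: inj_row_free => s sg.
have v0 := mulN_neq0 y0; set v := y *m N0 in v0.
suff : s *m N0 = 0 by move=> h; rewrite -[s]mulmx1 -NM mulmxA h mul0mx.
apply: (hess_energy_definite lam1 v0).
have hs j : hess_energy lam v (s *m N0) (e j *m N0) = 0.
  have := congr1 (fun A : 'rV[R]_n => 2 * A 0 j) sg; rewrite !mxE mulr0 => <-.
  rewrite hess_energyC {1}(row_sum_delta s) mulmx_suml.
  under eq_bigr do rewrite -scalemxAl.
  rewrite (lin_sum (W := R^o) _ _ _ (hess_energy_lin lam v (e j *m N0))) mulr_sumr.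
  apply: eq_bigr => k _.
  by rewrite fundamental_tensorE// hess_energyC -/v /GRing.scale/=; field.
rewrite {2}(row_sum_delta s) mulmx_suml.
under eq_bigr do rewrite -scalemxAl.
rewrite (lin_sum (W := R^o) _ _ _ (hess_energy_lin lam v (s *m N0))) big1// => k _.
by rewrite hs scaler0.
Qed.

Lemma Dcoframe_delta l : D (e l) = Nd l.
Proof.
rewrite /D (bigD1 l)//= mxE !eqxx scale1r big1 ?addr0// => j jl.
by rewrite mxE eqxx (negPf jl) scale0r.
Qed.

(** The bracket produced by the Maurer-Cartan equation is absorbed by the
    Euler-Arnold equation; what remains is the fundamental tensor applied to the
    claimed spray, and inverting that tensor returns it. *)
Lemma sprayE y i : y != 0 ->
  spray F p x0 y i = 2^-1 * ((y *m D y + randers_acc c lam (y *m N0)) *m M) 0 i.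
Proof.
move=> y0; have v0 := mulN_neq0 y0; set v := y *m N0 in v0 *.
set s := (_ + _) *m M.
have sN : s *m N0 = y *m D y + randers_acc c lam v by rewrite /s -mulmxA MN mulmx1.
set g := fundamental_tensor F p x0 y.
have rhs l : \sum_m partial l (fun y' => partial m (fun x' => F p x' y' ^+ 2) x0) y
              * y 0 m - partial l (fun x' => F p x' y ^+ 2) x0
           = 2 * (g *m s^T) l 0.
  transitivity (hess_energy lam v (e l *m N0) (s *m N0)).
    rewrite sN -[y *m D y]scale1r hess_energy_lin.
    rewrite (hess_energyC _ _ _ (randers_acc c lam v)) euler_arnold//.
    rewrite partial_x// -/v.
    under eq_bigr do rewrite partial_yx// mulrDl -/v.
    rewrite big_split/=.
    have -> : \sum_m hess_energy lam v (e l *m N0) (y *m Nd m) * y 0 m =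
        hess_energy lam v (e l *m N0) (y *m D y).
      rewrite mulmx_sumr; under [in RHS]eq_bigr do rewrite -scalemxAr.
      rewrite (lin_sum (W := R^o) _ _ _ (hess_energy_lin lam v _)).
      by apply: eq_bigr => m _; rewrite mulrC.
    have -> : \sum_m denergy lam v (e l *m Nd m) * y 0 m =
        denergy lam v (e l *m D y).
      rewrite mulmx_sumr; under [in RHS]eq_bigr do rewrite -scalemxAr.
      rewrite (lin_sum (W := R^o) _ _ _ (denergy_lin lam v)).
      by apply: eq_bigr => m _; rewrite mulrC.
    have := maurer_cartan y (e l); rewrite Dcoframe_delta -/v => mc.
    have -> : e l *m D y = (-1) *: lie_bracket c v (e l *m N0) + y *m Nd l.
      by rewrite scaleN1r -mc subrK.
    by rewrite denergy_lin; ring.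
  rewrite {1}(row_sum_delta s) mulmx_suml.
  under eq_bigr do rewrite -scalemxAl.
  rewrite (lin_sum (W := R^o) _ _ _ (hess_energy_lin lam v _)) mxE mulr_sumr.
  apply: eq_bigr => k _; rewrite fundamental_tensorE// -/v !mxE /GRing.scale/=.
  by field.
rewrite /spray -/g; under eq_bigr do rewrite rhs mulrCA.
have -> : \sum_l 2 * (invmx g i l * (g *m s^T) l 0) = 2 * s 0 i.
  rewrite -mulr_sumr; congr (_ * _).
  transitivity ((invmx g *m (g *m s^T)) i 0); first by rewrite mxE.
  by rewrite mulKmx ?fundamental_tensor_unit// mxE.
by field.
Qed.

(** Twice the factor P of the projective change G = G_alpha + P y. *)
Definition proj_factor (v : 'rV[R]_n) : R :=
  dot v (lie_bracket c v lam) / rnorm lam v.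
Definition dproj_factor (v w : 'rV[R]_n) : R :=
  (dot w (lie_bracket c v lam) + dot v (lie_bracket c w lam)) / rnorm lam v
  - dot v (lie_bracket c v lam) * drnorm lam v w / rnorm lam v ^+ 2.

Lemma dproj_factor_lin v k u w :
  dproj_factor v (k *: u + w) = k * dproj_factor v u + dproj_factor v w.
Proof.
rewrite /dproj_factor lie_bracket_linl drnorm_lin.
by rewrite !(dotDl, dotDr, dotZl, dotZr); ring.
Qed.

Lemma dproj_factor_euler v : v != 0 -> dproj_factor v v = proj_factor v.
Proof.
move=> v0; rewrite /dproj_factor /proj_factor drnorm_euler//.
by field; rewrite gt_eqF ?rnorm_gt0.
Qed.

Lemma is_derive_proj_factor y d : y != 0 ->
  is_derive y d (fun z => proj_factor (z *m N0)) (dproj_factor (y *m N0) (d *m N0)).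
Proof.
move=> y0; have v0 := mulN_neq0 y0.
have f0 : rnorm lam (y *m N0) != 0 by rewrite gt_eqF ?rnorm_gt0.
have hv := is_derive_mulN y d N0.
have hb : is_derive y d (fun z => lie_bracket c (z *m N0) lam)
    (lie_bracket c (d *m N0) lam).
  by apply: is_derive_lin => k u v; rewrite mulmxDl -scalemxAl lie_bracket_linl.
have hi := @is_deriveV R id (rnorm lam (y *m N0)) 1 1 f0 (is_derive_id _ _).
have hV := is_derive_chain (is_derive_rnorm lam hv v0) hi.
refine (is_derive_eq (is_derive_mul (is_derive_dot hv hb) hV) _).
by rewrite /dproj_factor /GRing.scale/=; field.
Qed.

Definition dgeodesic (y d : 'rV[R]_n) : 'rV[R]_n :=
  let v := y *m N0 in let w := d *m N0 in
  d *m D y + y *m D d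
  + (w *m driem_acc c v + (dproj_factor v w *: v + proj_factor v *: w)).

Lemma is_derive_geodesic y d : y != 0 ->
  is_derive y d (fun z => z *m D z + randers_acc c lam (z *m N0)) (dgeodesic y d).
Proof.
move=> y0; have hv := is_derive_mulN y d N0.
have D_lin k u v : D (k *: u + v) = k *: D u + D v.
  rewrite /D scaler_sumr -big_split; apply: eq_bigr => m _ /=.
  by rewrite !mxE scalerDl scalerA.
have hD : is_derive y d D (D d) by exact: is_derive_lin.
have had : is_derive y d (fun z => (ad c (z *m N0))^T) (ad c (d *m N0))^T.
  by apply: is_derive_lin => k u v; rewrite mulmxDl -scalemxAl ad_lin linearP.
apply: is_deriveD; first exact: is_derive_mulmx (is_derive_id y d) hD.
apply: is_deriveD; last exact: is_derive_scale (is_derive_proj_factor d y0) hv.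
by rewrite mul_driem_acc; apply: is_deriveN; exact: is_derive_mulmx.
Qed.

Lemma sum_delta_mul (A : 'M[R]_n) : \sum_m (e m *m A) 0 m = \tr A.
Proof. by apply: eq_bigr => m _; rewrite -rowE mxE. Qed.

Lemma trace_frame (A : 'M[R]_n) : \sum_m (e m *m N0 *m A *m M) 0 m = \tr A.
Proof.
under eq_bigr do rewrite -!mulmxA; rewrite sum_delta_mul.
by rewrite mulmxA mxtrace_mulC mulmxA MN mul1mx.
Qed.

(** By Maurer-Cartan the two halves of the derivative of y (D_y N) agree up to the
    trace of [ad v]. Traces may be taken in the frame, where those of [ad v] and
    of the differential of [riem_acc] vanish; the factor n + 1 comes from
    div(P y) = n P + dP(y) and the homogeneity of P. *)
Lemma spray_divergence y : y != 0 ->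
  \sum_m partial m (fun z => spray F p x0 z m) y =
  \tr (D y *m M) + n.+1%:R / 2 * proj_factor (y *m N0).
Proof.
move=> y0; have v0 := mulN_neq0 y0; set v := y *m N0 in v0 *.
have pE m : partial m (fun z => spray F p x0 z m) y =
    2^-1 * (dgeodesic y (e m) *m M) 0 m.
  apply: (@near_partial _
    (fun z => 2^-1 * ((z *m D z + randers_acc c lam (z *m N0)) *m M) 0 m)).
    by near=> z; rewrite sprayE//; near: z; exact: near_neq0.
  have h1 := is_derive_mulmx (is_derive_geodesic (e m) y0) (is_derive_cst M y (e m)).
  have /is_derive_mxP/(_ 0 m) h2 := h1.
  refine (is_derive_eq (is_derive_mul (is_derive_cst (2^-1 : R) y (e m)) h2) _).
  by rewrite mulmx0 addr0 mul0r add0r.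
under eq_bigr do rewrite pE; rewrite -mulr_sumr.
have gE m : (dgeodesic y (e m) *m M) 0 m =
    2 * (e m *m (D y *m M)) 0 m + (e m *m N0 *m ad c v *m M) 0 m
    + ((e m *m N0 *m driem_acc c v *m M) 0 m
       + (y 0 m * dproj_factor v (e m *m N0) + proj_factor v)).
  have := maurer_cartan y (e m); rewrite -/v => mc.
  have -> : dgeodesic y (e m) = e m *m D y + (e m *m D y + e m *m N0 *m ad c v)
     + (e m *m N0 *m driem_acc c v
        + (dproj_factor v (e m *m N0) *: v + proj_factor v *: (e m *m N0))).
    rewrite /dgeodesic -/v mul_ad; congr (_ + _ + _).
    by rewrite -[lie_bracket _ _ _]opprK -mc opprB addrC subrK.
  rewrite !mulmxDl -!scalemxAl.
  rewrite -[v *m M]mulmxA NM mulmx1 -[e m *m N0 *m M]mulmxA NM mulmx1.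
  have addE (A B : 'rV[R]_n) : (A + B) 0 m = A 0 m + B 0 m by rewrite mxE.
  have scaleE k (A : 'rV[R]_n) : (k *: A) 0 m = k * A 0 m by rewrite mxE.
  have ee : e m 0 m = 1 by rewrite mxE !eqxx.
  rewrite !addE !scaleE ee mulr1 -!mulmxA; ring.
under eq_bigr do rewrite gE.
rewrite !big_split/= -mulr_sumr sum_delta_mul !trace_frame tr_ad// tr_driem_acc//.
have -> : \sum_m y 0 m * dproj_factor v (e m *m N0) = proj_factor v.
  have vE : v = \sum_m y 0 m *: (e m *m N0).
    rewrite /v {1}(row_sum_delta y) mulmx_suml.
    by apply: eq_bigr => m _; rewrite -scalemxAl.
  rewrite -dproj_factor_euler// [X in _ = dproj_factor v X]vE.
  by rewrite (lin_sum (W := R^o) _ _ _ (dproj_factor_lin v)).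
rewrite sumr_const card_ord -mulr_natl -[n.+1]addn1 natrD.
by field.
Unshelve. all: by end_near. Qed.

Lemma partial_ln_bh_density m :
  partial m (fun x => ln (bh_density F p x)) x0 = \tr (Nd m *m M).
Proof.
pose C := ball_vol n (1 : R) / indicatrix_const lam.
have C0 : 0 < C by rewrite divr_gt0 ?ball_vol_gt0 ?indicatrix_const_gt0.
have d0 : \det N0 != 0.
  by have := nbhs_singleton hNu; rewrite unitmxE unitfE.
have dd0 : 0 < \det N0 * \det N0 by rewrite -expr2 exprn_even_gt0.
(* sqrt(det ^+ 2) stands for |det|, so that the chain rule applies directly. *)
apply: (@near_partial _ (fun x => ln (C * Num.sqrt (\det (N x) * \det (N x))))).
  near=> x; congr ln.
  have uN : N x \in unitmx by near: x; exact: hNu.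
  have hx : forall y, F p x y = rnorm lam (y *m N x) by near: x; exact: hF.
  rewrite /bh_density.
  have -> : [set y | F p x y < 1] = [set y | rnorm lam (y *m N x) < 1].
    by apply/seteqP; split=> y /=; rewrite hx.
  rewrite volume_indicatrix// -expr2 sqrtr_sqr /C [fine _%:E]/=.
  move: (indicatrix_const lam) => K.
  by rewrite invfM invrK mulrAC mulrA.
have hd := is_derive_det (hN m).
have hs := is_derive_chain (is_derive_mul hd hd) (is_derive1_sqrt dd0).
have hCs := is_derive_mul (is_derive_cst C x0 (e m)) hs.
have s0 : 0 < C * Num.sqrt (\det N0 * \det N0) by rewrite mulr_gt0// sqrtr_gt0.
refine (is_derive_eq (is_derive_chain hCs (is_derive1_ln s0)) _).
have adjE : \adj N0 = \det N0 *: M.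
  by rewrite -[LHS]mul1mx -MN -mulmxA mul_mx_adj mul_mx_scalar.
rewrite adjE -scalemxAr mxtraceZ /=; set t := \tr _.
set d := \det N0; rewrite -/d in dd0 d0 s0.
have r0 : Num.sqrt (d * d) != 0 by rewrite gt_eqF// sqrtr_gt0.
have rr : Num.sqrt (d * d) ^+ 2 = d * d by rewrite sqr_sqrtr// ltW.
transitivity (d * d * t / Num.sqrt (d * d) ^+ 2).
  by rewrite /cst; field; rewrite r0 gt_eqF.
by rewrite rr; field.
Unshelve. all: by end_near. Qed.

(** The divergence of the spray and the derivative of the log density share the
    term tr((D_y N) M). *)
Theorem S_curvature_left_invariant y : y != 0 ->
  S_curvature F p x0 y =
  n.+1%:R / 2 * (dot (y *m N0) (lie_bracket c (y *m N0) lam) / F p x0 y).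
Proof.
move=> y0; rewrite /S_curvature spray_divergence// F_at.
under eq_bigr do rewrite partial_ln_bh_density.
have -> : \sum_m y 0 m * \tr (Nd m *m M) = \tr (D y *m M).
  rewrite /D mulmx_suml linear_sum; apply: eq_bigr => m _.
  by rewrite /= -scalemxAl mxtraceZ.
by rewrite addrAC subrr add0r.
Qed.

End left_invariant_spray.

(** * Orthonormal frames with constant structure coefficients *)

Section frame.
Context {R : realType} {T : topologicalType} {n : nat}.
Variables (p : chart R T n) (h : @tensor2 R T n) (E : 'I_n -> @field R T n).
Variables (x0 : 'rV[R]_n) (c : 'I_n -> 'I_n -> 'rV[R]_n) (lam : 'rV[R]_n).
Local Notation e i := (delta_mx 0 i : 'rV[R]_n).

Definition frame_mx (x : 'rV[R]_n) : 'M[R]_n := \matrix_i E i p x.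
Definition coframe_mx (x : 'rV[R]_n) : 'M[R]_n := h p x *m (frame_mx x)^T.
Local Notation Mf := frame_mx.
Local Notation Nf := coframe_mx.

Hypothesis x0p : cod p x0.
Hypothesis orthonormal : forall x, cod p x -> forall i j,
  inner h p x (E i p x) (E j p x) = (i == j)%:R.
Hypothesis E_diff : forall i, differentiable (E i p) x0.
Hypothesis h_diff : forall i j, differentiable (fun x => h p x i j) x0.
Hypothesis E_bracket : forall i j,
  bracket (E i) (E j) p x0 = c i j *m Mf x0.

Lemma frame_coframe x : cod p x -> Mf x *m Nf x = 1%:M.
Proof.
move=> px; apply/matrixP => i j; rewrite [RHS]mxE -(orthonormal px) /inner.
have -> : E i p x = row i (Mf x) by rewrite rowK.
have -> : E j p x = row j (Mf x) by rewrite rowK.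
by rewrite tr_row -!row_mul [RHS]mxE colE mulmxA -colE [RHS]mxE mulmxA.
Qed.

Lemma coframe_frame x : cod p x -> Nf x *m Mf x = 1%:M.
Proof. by move=> px; apply: mulmx1C; exact: frame_coframe. Qed.

Lemma innerE x y z : cod p x -> inner h p x y z = dot (y *m Nf x) (z *m Nf x).
Proof.
move=> px; rewrite /inner /dot trmx_mul.
congr (_ _ _); rewrite -[h p x]mulmx1 -trmx1 -(coframe_frame px) trmx_mul.
by rewrite !mulmxA.
Qed.

Lemma inner_frame x v y : cod p x ->
  inner h p x (v *m Mf x) y = dot v (y *m Nf x).
Proof. by move=> px; rewrite innerE// -mulmxA frame_coframe// mulmx1. Qed.

Lemma randers_frame (X : @field R T n) x y : cod p x -> X p x = lam *m Mf x ->
  randers h X p x y = rnorm lam (y *m Nf x).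
Proof. by move=> px Xx; rewrite /randers Xx inner_frame// innerE. Qed.

Lemma derivable_frame d : derivable Mf x0 d.
Proof.
apply/derivable_mxP => i j.
rewrite (_ : (fun x => _) = fun x => E i p x 0 j); last first.
  by rewrite funeqE => x; rewrite mxE.
by move: (@diff_derivable _ _ _ _ _ d (E_diff i)) => /derivable_mxP; apply.
Qed.

Lemma derivable_coframe d : derivable Nf x0 d.
Proof.
have hM := derivableP (@derivable_frame d).
have hMT : is_derive x0 d (fun x => (Mf x)^T) ('D_d Mf x0)^T.
  apply/is_derive_mxP => i j; rewrite mxE.
  have -> : (fun x => (Mf x)^T i j) = fun x => Mf x j i.
    by rewrite funeqE => x; rewrite mxE.
  by move/is_derive_mxP: hM; apply.
have hh : derivable (h p) x0 d.
  by apply/derivable_mxP => i j; apply: diff_derivable.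
by have [] := is_derive_mulmx (derivableP hh) hMT.
Qed.

Definition dframe m := 'D_(e m) Mf x0.
Definition dcoframe m := 'D_(e m) Nf x0.

Lemma is_derive_coframe m : is_derive x0 (e m) Nf (dcoframe m).
Proof. exact/derivableP/derivable_coframe. Qed.

Lemma near_cod : \forall x \near x0, cod p x.
Proof. by apply: open_nbhs_nbhs; split => //; exact: chart_open_cod. Qed.

(** Differentiate M N = 1. *)
Lemma dcoframeE m : dcoframe m = - (Nf x0 *m dframe m *m Nf x0).
Proof.
have h1 := is_derive_mulmx (derivableP (@derivable_frame (e m)))
  (is_derive_coframe m).
have h2 : is_derive x0 (e m) (fun x => Mf x *m Nf x) 0.
  apply: near_eq_is_derive (is_derive_cst 1%:M x0 (e m)).
  by near=> x; rewrite frame_coframe//; near: x; exact: near_cod.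
have [_ d1] := h1; have [_ d2] := h2; move: d1; rewrite d2 => /esym/eqP.
rewrite addrC addr_eq0 => /eqP/(congr1 (mulmx (Nf x0))).
by rewrite mulmxA coframe_frame// mul1mx mulmxN mulmxA.
Unshelve. all: by end_near. Qed.

Definition dframe_along (v : 'rV[R]_n) : 'M[R]_n := \sum_m v 0 m *: dframe m.

Lemma dframe_along_lin k u v :
  dframe_along (k *: u + v) = k *: dframe_along u + dframe_along v.
Proof.
rewrite /dframe_along scaler_sumr -big_split; apply: eq_bigr => m _ /=.
by rewrite !mxE scalerDl scalerA.
Qed.

Lemma derive_E v j : 'D_v (E j p) x0 = e j *m dframe_along v.
Proof.
rewrite deriveE; last exact: E_diff.
rewrite (lin_delta (linearP ('d (E j p) x0))) mulmx_sumr; apply: eq_bigr => m _.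
rewrite -scalemxAr; congr (_ *: _); rewrite -deriveE; last exact: E_diff.
rewrite -rowE; apply/rowP => k; rewrite !mxE.
rewrite derive_mx; last exact/diff_derivable/E_diff.
rewrite /dframe derive_mx ?mxE; last exact: derivable_frame.
have -> : (fun x => Mf x j k) = fun x => E j p x 0 k; last by [].
by rewrite funeqE => x; rewrite mxE.
Qed.

(** Both sides are bilinear and agree on pairs of basis vectors, where the left
    one is the coordinate bracket of two frame fields. *)
Lemma bracket_frame u w :
  w *m dframe_along (u *m Mf x0) - u *m dframe_along (w *m Mf x0) =
  lie_bracket c u w *m Mf x0.
Proof.
pose f u w := w *m dframe_along (u *m Mf x0) - u *m dframe_along (w *m Mf x0).
have f_linl w' k u1 u2 : f (k *: u1 + u2) w' = k *: f u1 w' + f u2 w'.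
  rewrite /f !mulmxDl -!scalemxAl dframe_along_lin mulmxDr -scalemxAr scalerBr.
  by rewrite opprD addrACA.
have f_linr u' k w1 w2 : f u' (k *: w1 + w2) = k *: f u' w1 + f u' w2.
  rewrite /f !mulmxDl -!scalemxAl dframe_along_lin mulmxDr -scalemxAr scalerBr.
  by rewrite opprD addrACA.
rewrite -/(f u w) (lin_delta (f_linl w)) /lie_bracket mulmx_suml.
apply: eq_bigr => i _.
rewrite (lin_delta (f_linr _)) scaler_sumr mulmx_suml; apply: eq_bigr => j _.
rewrite scalerA -scalemxAl -E_bracket /bracket !derive_E /f.
by rewrite -!rowE !rowK.
Qed.

(** The bracket relations of the frame, rewritten for the dual coframe by means
    of dN = - N (dM) N. *)
Lemma maurer_cartan_frame y z :
  z *m Dcoframe dcoframe y - y *m Dcoframe dcoframe z =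
  - lie_bracket c (y *m Nf x0) (z *m Nf x0).
Proof.
have DE v : Dcoframe dcoframe v = - (Nf x0 *m dframe_along v *m Nf x0).
  rewrite /dframe_along mulmx_sumr mulmx_suml -sumrN; apply: eq_bigr => m _.
  by rewrite dcoframeE -scalemxAr -scalemxAl scalerN.
have NK u : u *m Nf x0 *m Mf x0 = u by rewrite -(mulmxA u) coframe_frame// mulmx1.
have MK u : u *m Mf x0 *m Nf x0 = u by rewrite -(mulmxA u) frame_coframe// mulmx1.
have := bracket_frame (y *m Nf x0) (z *m Nf x0); rewrite !NK.
move=> /(congr1 (fun A => A *m Nf x0)); rewrite MK => <-.
by rewrite !DE !mulmxN mulmxBl !mulmxA opprB opprK addrC.
Qed.

End frame.

(** Orthonormality is required on the whole chart because the density and the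
    spray differentiate the metric in [x]; the bracket relations enter through the
    Maurer-Cartan equation at the single point [x0]. *)
Theorem S_curvature_frame (R : realType) (T : topologicalType) (n : nat)
    (p : chart R T n) (h : @tensor2 R T n) (E : 'I_n -> @field R T n)
    (X : @field R T n) (x0 : 'rV[R]_n) (c : 'I_n -> 'I_n -> 'rV[R]_n)
    (lam v : 'rV[R]_n) :
  cod p x0 ->
  (forall x, cod p x -> forall i j,
     inner h p x (E i p x) (E j p x) = (i == j)%:R) ->
  (forall i, differentiable (E i p) x0) ->
  (forall i j, differentiable (fun x => h p x i j) x0) ->
  (forall i j, bracket (E i) (E j) p x0 = c i j *m frame_mx p E x0) ->
  (forall x, cod p x -> X p x = lam *m frame_mx p E x) ->
  dot lam lam < 1 ->
  (forall i j, c i j = - c j i) ->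
  (forall i j, dot lam (c i j) = 0) ->
  (forall i, \sum_k c i k 0 k = 0) ->
  v != 0 ->
  let y := v *m frame_mx p E x0 in
  S_curvature (randers h X) p x0 y =
  n.+1%:R / 2 * (dot v (lie_bracket c v lam) / randers h X p x0 y).
Proof.
move=> px0 hE Ed hd Eb XE lam1 c_anti lam_orth unimod v0 y.
have MN := frame_coframe hE px0.
have yN : y *m coframe_mx p h E x0 = v by rewrite -mulmxA MN mulmx1.
have y0 : y != 0.
  by apply: contra v0 => /eqP y0; rewrite -yN y0 mul0mx.
rewrite -yN.
apply: (@S_curvature_left_invariant _ _ _ p _ lam c x0 (coframe_mx p h E)
  (dcoframe p h E x0) (frame_mx p E x0)) => //.
- by move=> m; exact: is_derive_coframe.
- near=> x; have px : cod p x by near: x; exact: near_cod.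
  by case: (mulmx1_unit (frame_coframe hE px)).
- near=> x; have px : cod p x by near: x; exact: near_cod.
  by move=> z; apply: randers_frame => //; exact: XE.
- exact: maurer_cartan_frame.
Unshelve. all: by end_near. Qed.

(** * The Lie algebra l_{5,5} *)

Section l55.
Context {R : realType} (a b c d e : R).

(** Only the brackets with [i < j] are listed; antisymmetrization gives the
    others. Coordinates beyond the end of a list read as 0. *)
Definition l55_half (i j : nat) : seq R :=
  match i, j with
  | 0, 1 => [:: 0; 0; 0; a; b]
  | 0, 2 => [:: 0; 0; 0; 0; c]
  | 0, 3 => [:: 0; 0; 0; 0; d]
  | 1, 2 => [:: 0; 0; 0; 0; e]
  | _, _ => [::]
  end.

Definition l55 (i j : 'I_5) : 'rV[R]_5 :=
  \row_k (l55_half i j)`_k - \row_k (l55_half j i)`_k.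

Lemma l55_anti i j : l55 i j = - l55 j i.
Proof. by rewrite /l55 opprB. Qed.

(** The sum is the trace of ad E_i, and the algebra is nilpotent. *)
Lemma l55_unimodular i : \sum_k l55 i k 0 k = 0.
Proof.
rewrite !big_ord_recl big_ord0 !mxE /=.
by case: i => [[|[|[|[|[|i]]]]] //= _]; rewrite !subrr ?addr0.
Qed.

Lemma l55_derived l1 l2 l3 i j :
  dot (\row_k [:: l1; l2; l3; 0; 0]`_k) (l55 i j) = 0.
Proof.
rewrite dotE !big_ord_recl big_ord0 !mxE /=.
by case: i => [[|[|[|[|[|i]]]]] //= _];
  case: j => [[|[|[|[|[|j]]]]] //= _]; ring.
Qed.

Lemma l55_quadratic l1 l2 l3 y1 y2 y3 y4 y5 :
  let v := \row_k [:: y1; y2; y3; y4; y5]`_k in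
  dot v (lie_bracket l55 v (\row_k [:: l1; l2; l3; 0; 0]`_k)) =
  (y1 * l2 - y2 * l1) * (a * y4 + b * y5) + y5 * l3 * (c * y1 + e * y2)
  - y5 * l1 * (c * y3 + d * y4) - e * l2 * y3 * y5.
Proof.
rewrite /= dotE.
(* The triple sum is reindexed over nat so that its 125 terms are computed from
   numerals; most of them vanish and are discarded before [ring]. *)
pose T k i j : R := [:: y1; y2; y3; y4; y5]`_k *
  ([:: y1; y2; y3; y4; y5]`_i * [:: l1; l2; l3; 0; 0]`_j *
   ((l55_half i j)`_k - (l55_half j i)`_k)).
transitivity (\sum_(k < 5) \sum_(i < 5) \sum_(j < 5) T k i j).
  apply: eq_bigr => k _; rewrite mxE summxE mulr_sumr; apply: eq_bigr => i _.
  rewrite summxE mulr_sumr; apply: eq_bigr => j _.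
  by rewrite /T !mxE.
have sum5 (f : nat -> R) : \sum_(i < 5) f i = f 0 + f 1 + f 2 + f 3 + f 4.
  by rewrite !big_ord_recr big_ord0/= add0r.
rewrite (sum5 (fun k => \sum_(i < 5) \sum_(j < 5) T k i j)).
pose T2 k i := \sum_(j < 5) T k i j.
rewrite !(sum5 (T2 _)) /T2 !(sum5 (T _ _)) /T /=.
rewrite !(mul0r, mulr0, add0r, addr0, subr0, sub0r, oppr0, subrr, mulrN, mulNr).
by ring.
Qed.

End l55.

Lemma row5_mul (R : realType) (M : 'M[R]_5) (s : seq R) :
  (\row_k s`_k) *m M = \sum_(k < 5) s`_k *: row k M.
Proof. by rewrite mulmx_sum_row; apply: eq_bigr => k _; rewrite mxE. Qed.

Lemma bracketC (R : realType) (T : topologicalType) n (X Y : @field R T n) p x :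
  bracket Y X p x = - bracket X Y p x.
Proof. by rewrite /bracket opprB. Qed.

Theorem theorem3p12 (R : realType) (G : preTopologicalGroupType)
  (A : set (chart R G 5))
  (hG : lie_group A) (hsc : simply_connected R G) (hnil : nilpotent_group G)
  (metric : @tensor2 R G 5) (hmetric : left_invariant_metric A metric)
  (a b c d e : R)
  (ha : 0 < a) (hb : 0 <= b) (hc : 0 <= c) (hd : 0 < d) (he : 0 < e)
  (E1 E2 E3 E4 E5 : @field R G 5)
  (hE : orthonormal_basis A metric (tnth [tuple E1; E2; E3; E4; E5]))
  (h12 : field_eq A (bracket E1 E2) (a *: E4 + b *: E5))
  (h13 : field_eq A (bracket E1 E3) (c *: E5))
  (h14 : field_eq A (bracket E1 E4) (d *: E5))
  (h15 : field_eq A (bracket E1 E5) 0)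
  (h23 : field_eq A (bracket E2 E3) (e *: E5))
  (h24 : field_eq A (bracket E2 E4) 0)
  (h25 : field_eq A (bracket E2 E5) 0)
  (h34 : field_eq A (bracket E3 E4) 0)
  (h35 : field_eq A (bracket E3 E5) 0)
  (h45 : field_eq A (bracket E4 E5) 0)
  (l1 l2 l3 : R) (X : @field R G 5)
  (hX : X = l1 *: E1 + l2 *: E2 + l3 *: E3)
  (hX1 : forall p, A p -> forall x, cod p x ->
     Num.sqrt (inner metric p x (X p x) (X p x)) < 1)
  (F : @tfunction R G 5) (hF : F = randers metric X)
  (hFinv : left_invariant_tfunction A F)
  (hFnR : ~ is_riemannian A F)
  (hFD : douglas A F)
  (y1 y2 y3 y4 y5 : R) (Y : @field R G 5)
  (hY : Y = y1 *: E1 + y2 *: E2 + y3 *: E3 + y4 *: E4 + y5 *: E5)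
  (p : chart R G 5) (hp : A p) (hp1 : dom p 1%g)
  (hY0 : Y p (crd p 1%g) != 0) :
  S_curvature F p (crd p 1%g) (Y p (crd p 1%g)) =
  3 * (((y1 * l2 - y2 * l1) * (a * y4 + b * y5)
        + y5 * l3 * (c * y1 + e * y2)
        - y5 * l1 * (c * y3 + d * y4)
        - e * l2 * y3 * y5)
       / F p (crd p 1%g) (Y p (crd p 1%g))).
Proof.
set x0 := crd p 1%g; set E := tnth [tuple E1; E2; E3; E4; E5] in hE.
have px0 : cod p x0 by exact: chart_crd.
pose lam : 'rV[R]_5 := \row_k [:: l1; l2; l3; 0; 0]`_k.
pose v : 'rV[R]_5 := \row_k [:: y1; y2; y3; y4; y5]`_k.
have row_frame s x : (\row_k s`_k) *m frame_mx p E x =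
    s`_0 *: E1 p x + s`_1 *: E2 p x + s`_2 *: E3 p x + s`_3 *: E4 p x
    + s`_4 *: E5 p x.
  by rewrite row5_mul !big_ord_recl big_ord0 !rowK addr0 !addrA.
have XE x : X p x = lam *m frame_mx p E x.
  by rewrite row_frame /= !scale0r !addr0 hX.
have YE : Y p x0 = v *m frame_mx p E x0 by rewrite row_frame hY.
have [hEinv hEo] := hE.
have lam1 : dot lam lam < 1.
  have := hX1 p hp x0 px0; rewrite XE (inner_frame (hEo p hp) _ _ px0).
  rewrite -mulmxA (frame_coframe (hEo p hp) px0) mulmx1.
  by rewrite -{1}sqrtr1 ltr_sqrt.
have v0 : v != 0 by apply: contra hY0 => /eqP v0; rewrite YE v0 mul0mx.
have at0 (Z W : @field R G 5) : field_eq A Z W -> Z p x0 = W p x0.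
  by move=> ZW; exact: ZW.
have brackets := (at0 _ _ h12, at0 _ _ h13, at0 _ _ h14, at0 _ _ h15, at0 _ _ h23,
            at0 _ _ h24, at0 _ _ h25, at0 _ _ h34, at0 _ _ h35, at0 _ _ h45).
have bE (i j : 'I_5) :
    bracket (E i) (E j) p x0 = l55 a b c d e i j *m frame_mx p E x0.
  rewrite mulmxBl !row_frame.
  case: i => [[|[|[|[|[|i]]]]] //= ?]; case: j => [[|[|[|[|[|j]]]]] //= ?];
    rewrite !(scale0r, add0r, addr0, subr0, sub0r, oppr0) /E /tnth /=;
    first [by rewrite brackets | by rewrite bracketC brackets ?oppr0
          | by rewrite /bracket subrr].
rewrite hF YE.
rewrite (S_curvature_frame (c := l55 a b c d e) (lam := lam) px0 (hEo p hp))//.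
- by rewrite l55_quadratic; congr (_ * _); lra.
- move=> i; have [[sm _] _] := hEinv i; exact: (sm p hp [::] x0 px0).
- by move=> i j; have [[sm _ _ _] _] := hmetric; exact: (sm p hp i j [::] x0 px0).
- exact: l55_anti.
- exact: l55_derived.
- exact: l55_unimodular.
Qed.
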